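(* Let $n\ge 1$ and let $(l_1,\dots,l_{n+1})$ be a generic family of linear forms on $\mathbf{C}^n$ (every subfamily of $n$ elements has rank $n$) whose kernels are pairwise distinct. Then the Bernstein ideal $\mathcal{B}(l_1,\dots,l_{n+1})\subset \mathbf{C}[s_1,\dots,s_{n+1}]$ is principal, generated by $$\prod_{j=1}^{n+1}(s_j+1)\ \prod_{k=0}^{n}(s_1+\cdots+s_{n+1}+n+k).$$
   Context: Let $A_n(\mathbf{C})$ be the Weyl algebra of differential operators with coefficients in $\mathbf{C}[x_1,\dots,x_n]$. For nonzero polynomials $f_1,\dots,f_p\in\mathbf{C}[x_1,\dots,x_n]$, the symbol $f_1^{s_1}\cdots f_p^{s_p}$ generates a free rank-one module over $\mathbf{C}[x_1,\dots,x_n,s_1,\dots,s_p,\frac{1}{f_1\cdots f_p}]$, on which $A_n(\mathbf{C})[s_1,\dots,s_p]$ (the $s_i$ being central variables) acts by $\partial_{x_k}(g\, f_1^{s_1}\cdots f_p^{s_p})=\bigl(\partial_{x_k}g+g\sum_i s_i\frac{\partial_{x_k}f_i}{f_i}\bigr)f_1^{s_1}\cdots f_p^{s_p}$. One sets $f_1^{s_1+1}\cdots f_p^{s_p+1}=f_1\cdots f_p\, f_1^{s_1}\cdots f_p^{s_p}$. The Bernstein ideal $\mathcal{B}(f_1,\dots,f_p)$ is the ideal of all $b\in\mathbf{C}[s_1,\dots,s_p]$ such that $b(s_1,\dots,s_p)\,f_1^{s_1}\cdots f_p^{s_p}\in A_n(\mathbf{C})[s_1,\dots,s_p]\,f_1^{s_1+1}\cdots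 f_p^{s_p+1}$. *)

(* Defs.v *)
From HB Require Import structures.
From mathcomp Require Import all_boot all_order all_algebra.
From mathcomp Require Import reals complex.
From mathcomp Require Import mpoly.
From mathcomp Require Import ring.

Set Implicit Arguments.
Unset Strict Implicit.
Unset Printing Implicit Defensive.

Import GRing.Theory.
Local Open Scope ring_scope.
Local Open Scope quotient_scope.

Notation "x %:F" := (@FracField.tofrac _ x) : ring_scope.

Section BernsteinIdeal.

Variables (C : fieldType) (n p : nat).

(* C[x_1..x_n, s_1..s_p] is {mpoly C[n + p]}: x_i is 'X_(lshift p i) and s_j is
   'X_(rshift n j). *)
Definition xpoly (a : {mpoly C[n]}) : {mpoly C[n + p]} :=
  a \mPo [tuple 'X_(lshift p i) | i < n].

Definition spoly (b : {mpoly C[p]}) : {mpoly C[n + p]} :=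
  b \mPo [tuple 'X_(rshift n j) | j < p].

(* The derivation d/dx_k of C(x, s), given by the quotient rule on a
   representative; frac_derivE shows that the representative is irrelevant. *)
Definition frac_deriv (k : 'I_n) (g : {fraction {mpoly C[n + p]}}) :
    {fraction {mpoly C[n + p]}} :=
  let a := \n_(repr g) in
  let b := \d_(repr g) in
  (a^`M(lshift p k) * b - a * b^`M(lshift p k))%:F / (b ^+ 2)%:F.

Variable f : 'I_p -> {mpoly C[n]}.

(* The element g f_1^{s_1} ... f_p^{s_p} is represented by g.  Here g ranges over
   the field C(x, s), which contains C[x, s, 1 / (f_1 ... f_p)]; the latter is
   described by in_localization, and it is stable under the action
   (in_localization_fs_deriv), so that A_n(C)[s] f_1^{s_1+1} ... f_p^{s_p+1} is
   the same whether computed over C(x, s) or over the localization. *)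
Definition in_localization (g : {fraction {mpoly C[n + p]}}) : Prop :=
  exists (a : {mpoly C[n + p]}) (m : nat),
    g = a%:F / ((\prod_(i < p) xpoly (f i)) ^+ m)%:F.

Definition fs_deriv (k : 'I_n) (g : {fraction {mpoly C[n + p]}}) :
    {fraction {mpoly C[n + p]}} :=
  frac_deriv k g +
  g * \sum_(i < p)
        ('X_(rshift n i))%:F * ((xpoly (f i)^`M(k))%:F / (xpoly (f i))%:F).

Definition fs_derivm (m : 'X_{1..n}) (g : {fraction {mpoly C[n + p]}}) :
    {fraction {mpoly C[n + p]}} :=
  foldr (fun k => iter (m k) (fs_deriv k)) g (enum 'I_n).

(* A differential operator P in A_n(C)[s] is written in its normal form
   \sum_m P_m(x, s) d^m, with coefficients on the left; it is encoded as the
   polynomial in d_1, ..., d_n with coefficients P_m.  Only the additive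
   structure of the type {mpoly {mpoly C[n + p]}[n]} is meaningful here: the
   product of operators is not the product of polynomials. *)
Definition weyl_act (P : {mpoly {mpoly C[n + p]}[n]})
    (g : {fraction {mpoly C[n + p]}}) : {fraction {mpoly C[n + p]}} :=
  \sum_(m <- msupp P) (P@_m)%:F * fs_derivm m g.

Definition bernstein_ideal (b : {mpoly C[p]}) : Prop :=
  exists P : {mpoly {mpoly C[n + p]}[n]},
    (spoly b)%:F = weyl_act P (\prod_(i < p) xpoly (f i))%:F.

End BernsteinIdeal.

Definition linear_form (C : fieldType) (p n : nat) (A : 'M[C]_(p, n))
    (i : 'I_p) : {mpoly C[n]} :=
  \sum_(k < n) A i k *: 'X_k.

Section LocalizationTheory.

Variables (C : fieldType) (n p : nat).

Lemma quotient_rule_eq (T : comNzRingType) (a b u v a' b' u' v' : T) :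
  a' * v + a * v' = u' * b + u * b' -> a * v = u * b ->
  (u' * v - u * v') * b ^+ 2 = (a' * b - a * b') * v ^+ 2.
Proof.
move=> Ed E; have -> : (u' * v - u * v') * b ^+ 2 =
    b * v * (u' * b + u * b') - b * v' * (u * b) - v * b' * (u * b) by ring.
by rewrite -Ed -E; ring.
Qed.

Lemma inv_mul_eq (T : fieldType) (x y : T) : y != 0 -> x^-1 = y / (x * y).
Proof. by move=> y0; rewrite invfM mulrCA mulfV ?mulr1. Qed.

Lemma common_denominator_eq (T : fieldType) (u a h z w : T) :
  z != 0 -> w != 0 ->
  u / w ^+ 2 + a / w * (h / z) = (u * z + a * h * w) / (z * w ^+ 2).
Proof. by move=> z0 w0; field; rewrite z0 w0. Qed.

Lemma frac_derivE (k : 'I_n) (a b : {mpoly C[n + p]}) : b != 0 ->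
  frac_deriv k (a%:F / b%:F) =
  (a^`M(lshift p k) * b - a * b^`M(lshift p k))%:F / (b ^+ 2)%:F.
Proof.
move=> b0; rewrite /frac_deriv.
set g := a%:F / b%:F; set u := \n_(repr g); set v := \d_(repr g).
have v0 : v != 0 by exact: denom_ratioP.
have Eg : g = u%:F / v%:F.
  rewrite -[g in LHS]reprK.
  have -> : repr g = Ratio u v by rewrite Ratio_numden.
  apply/(mulIf (x := v%:F)); first by rewrite tofrac_eq0.
  rewrite divfK ?tofrac_eq0 //.
  unlock FracField.tofrac.
  rewrite -[LHS]FracField.pi_mul; apply/eqmodP => /=.
  rewrite FracField.equivfE /FracField.mulf !numden_Ratio ?mulf_neq0 ?oner_eq0 //.
  by rewrite !mulr1 mulrC.
have E : a * v = u * b.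
  apply/eqP; rewrite -tofrac_eq !tofracM; apply/eqP.
  have := Eg; rewrite /g => /(congr1 (fun z => z * (b%:F * v%:F))).
  by rewrite mulrA divfK ?tofrac_eq0 // [b%:F * _]mulrC mulrA divfK ?tofrac_eq0.
set d := mderiv (lshift p k).
have Ed : d a * v + a * d v = d u * b + u * d b by rewrite -!mderivM E.
apply/eqP; rewrite eqr_div ?tofrac_eq0 ?expf_neq0 //.
rewrite -!tofracM tofrac_eq; apply/eqP; rewrite -/d.
exact: quotient_rule_eq Ed E.
Qed.

Lemma xpoly_eq0 (a : {mpoly C[n]}) : (xpoly p a == 0) = (a == 0).
Proof.
apply/eqP/eqP => [a0|->]; last exact: raddf0.
pose t := [tuple (if split i is inl j then 'X_j else 0) | i < n + p]
  : (n + p).-tuple {mpoly C[n]}.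
have : xpoly p a \mPo t = 0 by rewrite a0 raddf0.
rewrite /xpoly [a in comp_mpoly _ a]comp_mpolyE raddf_sum /= => E.
rewrite -[LHS]comp_mpoly_id comp_mpolyE -[RHS]E; apply: eq_bigr => m _.
rewrite comp_mpolyZ rmorph_prod /=; congr (_ *: _); apply: eq_bigr => i _.
rewrite rmorphXn /= !tnth_mktuple comp_mpolyXU -tnth_nth tnth_mktuple.
by rewrite -[lshift p i]/(unsplit (inl i)) unsplitK.
Qed.

Lemma in_localization_fs_deriv (f : 'I_p -> {mpoly C[n]}) (k : 'I_n)
    (g : {fraction {mpoly C[n + p]}}) :
  (forall i, f i != 0) ->
  in_localization f g -> in_localization f (fs_deriv f k g).
Proof.
move=> f0 [a [m ->]]; rewrite /in_localization.
set F : {mpoly C[n + p]} := \prod_(i < p) xpoly p (f i).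
have xf0 i : xpoly p (f i) != 0 by rewrite xpoly_eq0.
have F0 : F != 0 by apply/prodf_neq0 => i _.
pose h : {mpoly C[n + p]} := \sum_(i < p) 'X_(rshift n i) * xpoly p (f i)^`M(k) *
            \prod_(j < p | j != i) xpoly p (f j).
have Fm0 : (F ^+ m)%:F != 0 by rewrite tofrac_eq0 expf_neq0.
have FF0 : F%:F != 0 by rewrite tofrac_eq0.
have -> : fs_deriv f k (a%:F / (F ^+ m)%:F) =
    frac_deriv k (a%:F / (F ^+ m)%:F) + (a%:F / (F ^+ m)%:F) * (h%:F / F%:F).
  rewrite /fs_deriv /h; congr (_ + _ * _).
  rewrite rmorph_sum /= mulr_suml; apply: eq_bigr => i _.
  rewrite !tofracM -!mulrA; congr (_ * (_ * _)).
  set G := \prod_(j < p | j != i) xpoly p (f j).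
  have G0 : G != 0 by apply/prodf_neq0.
  have -> : F = xpoly p (f i) * G by rewrite /F (bigD1 i).
  by rewrite (tofracM (xpoly p (f i)) G); apply: inv_mul_eq; rewrite tofrac_eq0.
rewrite frac_derivE ?expf_neq0 //; set u : {mpoly C[n + p]} := _ - _.
exists (u * F + a * h * F ^+ m), (m * 2).+1.
have -> : (F ^+ (m * 2).+1)%:F = F%:F * (F ^+ m)%:F ^+ 2.
  by rewrite tofracXn exprS exprM -tofracXn.
have -> : (u * F + a * h * F ^+ m)%:F = u%:F * F%:F + a%:F * h%:F * (F ^+ m)%:F.
  by rewrite tofracD !tofracM.
rewrite (tofracXn 2 (F ^+ m)).
exact: (common_denominator_eq u%:F a%:F h%:F FF0 Fm0).
Qed.

End LocalizationTheory.

(* Main.v *)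
Require Import Defs.
From HB Require Import structures.
From mathcomp Require Import all_boot all_order all_algebra.
From mathcomp Require Import reals complex.
From mathcomp Require Import ssrcomplements mpoly.
From mathcomp Require Import ring.

Set Implicit Arguments.
Unset Strict Implicit.
Unset Printing Implicit Defensive.

Import GRing.Theory Num.Theory.
Local Open Scope ring_scope.

(** Write [n + 1 = p], [F = l_1 ... l_p], [S = s_1 + ... + s_p], [M = A_n(C)[s] F f^s], and let
    [m] be the ideal [(x_1, ..., x_n)].

    Membership.  For [i <> j] there is a constant vector field killing every form except [l_i]
    and [l_j].  Applying it, then multiplying by [l_j], exchanges a factor [l_i] for
    [(s_i + 1) l_j]; by induction on [K], the element
    [prod_(j in K) (s_j + 1) * m^|K| * prod_(j notin K) l_j] of [C[x, s] f^s] lies in [M].  With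
    all factors exchanged, [prod_j (s_j + 1) m^(n+1) f^s] lies in [M], and the Euler relation
    [sum_k d_k (x_k g f^s) = (S + n + d) g f^s], valid modulo [m^(d+1)] for [g] in [m^d], lowers
    the power of [m] from [n + 1] to [0] at the cost of the factors [S + n + d], [d = n, ..., 0].

    Divisibility.  It suffices that [b] vanishes on a Zariski-dense set of points [alpha] of each
    hyperplane.  Let [V] be a set of rational functions stable under differential operators with
    polynomial coefficients; if [f^(alpha+1)] is in [V] and [f^alpha] is not, then
    [b(alpha) = 0].  For [s_j = -1] take the other [alpha_i] natural and [V] the polynomials.
    For [S = -(n + k)] take [alpha_i <= -2] for [i <= n], [alpha_(n+1)] natural and
    [V = sum_i C[x, 1 / prod_(j <> i, j <= n) l_j]]: as [l_(n+1)] is a combination of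
    [l_1, ..., l_n] with nonzero coefficients, a polynomial multiple of [f^alpha] is congruent
    modulo [V] to a nonzero multiple of [1 / (l_1 ... l_n)], which is not in [V], whereas
    [f^(alpha+1)] is in [V] because its degree [1 - k] exceeds [-n]. *)

(** * Divisibility of multivariate polynomials *)

Lemma mpoly_ring_ind (R : nzRingType) (n : nat) (Q : {mpoly R[n]} -> Prop) :
  (forall c, Q c%:MP) -> (forall i, Q 'X_i) ->
  (forall a b, Q a -> Q b -> Q (a + b)) ->
  (forall a b, Q a -> Q b -> Q (a * b)) -> forall a, Q a.
Proof.
move=> QC QX QD QM a; rewrite (mpolyE a).
apply: big_ind => [||m _]; [by rewrite -mpolyC0 | exact: QD |].
rewrite -mul_mpolyC; apply: (QM) => //; rewrite mpolyXE_id.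
apply: big_ind => [||i _]; [by rewrite -mpolyC1 | exact: QM |].
by elim: (m i) => [|k IH]; rewrite ?expr0 -?mpolyC1 // exprS; apply: (QM).
Qed.

Definition msubst (R : nzRingType) (n : nat) (j : 'I_n) (r : {mpoly R[n]}) :
    n.-tuple {mpoly R[n]} :=
  [tuple if i == j then r else 'X_i | i < n].

(** Substitution of [r] for ['X_j] is a ring morphism, so the congruence modulo ['X_j - r] only has
    to be checked on generators. *)
Lemma mpoly_modX (R : comNzRingType) (n : nat) (j : 'I_n) (r a : {mpoly R[n]}) :
  exists q, a = a \mPo msubst j r + q * ('X_j - r).
Proof.
elim/mpoly_ring_ind: a => [c|i|a b [q {1}->] [q' {1}->]|a b [q aE] [q' bE]].
- by exists 0; rewrite comp_mpolyC mul0r addr0.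
- rewrite comp_mpolyXU -tnth_nth tnth_mktuple; case: eqVneq => [->|_].
    by exists 1; ring.
  by exists 0; rewrite mul0r addr0.
- by exists (q + q'); rewrite comp_mpolyD; ring.
- exists (q * b + (a \mPo msubst j r) * q').
  rewrite rmorphM /=.
  have -> : a \mPo msubst j r = a - q * ('X_j - r) by rewrite {2}aE addrK.
  have -> : b \mPo msubst j r = b - q' * ('X_j - r) by rewrite {2}bE addrK.
  ring.
Qed.

(** The factors are divided out one at a time: on [Z t] the evaluations take values in a domain and
    the factors of the other indices do not vanish, so the cofactor already found still vanishes
    there. It serves both for constants substituted for one variable and for the hyperplanes of the
    Bernstein ideal. *)
Lemma dvd_prod_of_vanish (R : comNzRingType) (S : idomainType) (T : eqType)
    (U : Type) (ev : U -> {rmorphism R -> S}) (Z : T -> U -> Prop) (L : T -> R)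
    (s : seq T) (a : R) :
  uniq s ->
  (forall t b, t \in s -> (forall u, Z t u -> ev u b = 0) ->
     exists q, b = q * L t) ->
  (forall t t' u, t \in s -> t' \in s -> t != t' -> Z t u -> ev u (L t') != 0) ->
  (forall t u, t \in s -> Z t u -> ev u a = 0) ->
  exists q, a = q * \prod_(t <- s) L t.
Proof.
elim: s => [|t s IH] /=; first by exists a; rewrite big_nil mulr1.
case/andP => ts us dvdL L0 a0.
have [||||q aE] := IH.
- by [].
- by move=> t' b t's; apply: dvdL; rewrite inE t's orbT.
- by move=> t' t'' u i1 i2; apply: L0; rewrite inE ?i1 ?i2 orbT.
- by move=> t' u i1; apply: a0; rewrite inE i1 orbT.
have [||q' qE] := dvdL t q; first exact: mem_head.
  move=> u Zu; have /eqP := a0 t u (mem_head _ _) Zu.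
  rewrite aE rmorphM mulf_eq0 rmorph_prod => /orP[/eqP //|/eqP].
  move=> P0; have: \prod_(i <- s) ev u (L i) != 0.
    rewrite prodf_seq_neq0; apply/allP => t' t's /=.
    apply: (L0 t) => //; first exact: mem_head.
      by rewrite inE t's orbT.
    by apply: contraNneq ts => ->.
  by rewrite P0 eqxx.
by exists q'; rewrite big_cons aE qE mulrA.
Qed.

(** * Polynomials vanishing on an infinite grid *)

Section Grid.

Variables (F : fieldType) (n : nat) (phi : nat -> F).
Hypothesis phi_inj : injective phi.

(** Such an [a] is divisible by any product of distinct ['X_j - phi k], and [msize a] of these
    factors already have a product of larger degree than [a]. *)
Lemma msubst_grid_eq0 (j : 'I_n) (a : {mpoly F[n]}) :
  (forall k, a \mPo msubst j (phi k)%:MP = 0) -> a = 0.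
Proof.
move=> a0; apply/eqP; apply: contraTT isT => an0.
pose L k : {mpoly F[n]} := 'X_j - (phi k)%:MP.
have [||||q aE] := @dvd_prod_of_vanish _ _ _ _
  (fun k => comp_mpoly (msubst j (phi k)%:MP)) (fun t u => t = u) L
  (iota 0 (msize a)) a.
- exact: iota_uniq.
- move=> t b _ /(_ _ erefl) b0; have [q] := mpoly_modX j (phi t)%:MP b.
  by rewrite [_ \mPo _]b0 add0r; exists q.
- move=> t t' _ _ _ tt' <- /=; rewrite rmorphB /= comp_mpolyXU comp_mpolyC.
  rewrite -tnth_nth tnth_mktuple eqxx -mpolyCB mpolyC_eq0 subr_eq0.
  by apply: contraNneq tt' => /phi_inj ->.
- by move=> t u _ _ /=; apply: a0.
have sL k : (1 < msize (L k))%N.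
  rewrite -(mdeg1 j); apply: msize_mdeg_lt.
  by rewrite mcoeff_msupp mcoeffB mcoeffX mcoeffC eqxx mnm1_eq0 mulr0 subr0 oner_eq0.
have sP : (msize a < msize (\prod_(t <- iota 0 (msize a)) L t))%N.
  rewrite -{1}[msize a](size_iota 0).
  elim: (iota _ _) => [|t s IH]; first by rewrite big_nil msize1.
  rewrite big_cons msizeM -?msize_poly_eq0 -?lt0n ?(ltn_trans _ (sL t)) //.
    by rewrite -subn1 ltn_subRL add1n -addn2 addnC leq_add.
  exact: leq_ltn_trans IH.
have q0 : q != 0 by apply: contraNneq an0 => q0; rewrite aE q0 mul0r.
have P0 : \prod_(t <- iota 0 (msize a)) L t != 0.
  by apply: contraTneq sP => ->; rewrite msize0.
move: sP; rewrite {1}aE msizeM // ltnNge -subn1 leq_subRL ?leq_add2r.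
  by rewrite lt0n msize_poly_eq0 q0.
by rewrite addn_gt0 lt0n msize_poly_eq0 q0.
Qed.

Lemma mpoly_grid_eq0 (a : {mpoly F[n]}) :
  (forall z : 'I_n -> nat, a.@[fun i => phi (z i)] = 0) -> a = 0.
Proof.
move=> a0.
(* Only the variables listed in [s] are replaced by grid values; the induction frees them one at a
   time by [msubst_grid_eq0]. *)
pose sub (s : seq 'I_n) (z : 'I_n -> nat) : n.-tuple {mpoly F[n]} :=
  [tuple if i \in s then (phi (z i))%:MP else 'X_i | i < n].
suff /(_ (enum 'I_n) (enum_uniq _)): forall s, uniq s ->
    (forall z, a \mPo sub s z = 0) -> a = 0.
  apply=> z; rewrite -[RHS]mpolyC0 -(a0 z) comp_mpolyE mevalE raddf_sum.
  apply: eq_bigr => m _ /=; rewrite mpolyCM mul_mpolyC rmorph_prod /=.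
  congr (_ *: _); apply: eq_bigr => i _.
  by rewrite tnth_mktuple mem_enum rmorphXn.
elim=> [_ /(_ (fun=> 0%N))|j s IH /= /andP[js us] s0].
  suff -> : sub [::] (fun=> 0%N) = [tuple 'X_i | i < n] by rewrite comp_mpoly_id.
  by apply: eq_from_tnth => i; rewrite !tnth_mktuple.
apply: IH => // z; apply: (@msubst_grid_eq0 j) => k.
pose z' i := if i == j then k else z i.
rewrite -[RHS](s0 z'); elim/mpoly_ring_ind: a {a0 s0} => [c|i|b c|b c].
- by rewrite !comp_mpolyC.
- rewrite !comp_mpolyXU -!tnth_nth !tnth_mktuple inE /z'.
  have [->|ij] := eqVneq i j.
    rewrite (negPf js) comp_mpolyXU -tnth_nth tnth_mktuple eqxx //.
  case: ifP => _ /=; first by rewrite comp_mpolyC.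
  by rewrite comp_mpolyXU -tnth_nth tnth_mktuple (negPf ij).
- by rewrite !comp_mpolyD => -> ->.
- by rewrite !rmorphM /= => -> ->.
Qed.

(** The remainder [a \mPo msubst j r] of [mpoly_modX] takes at each grid point a value assumed to be
    zero, hence is zero. *)
Lemma dvd_hyperplane_of_grid (j : 'I_n) (r a : {mpoly F[n]}) :
  (forall z : 'I_n -> nat,
     a.@[fun i => if i == j then r.@[fun i => phi (z i)] else phi (z i)] = 0) ->
  exists q, a = q * ('X_j - r).
Proof.
move=> a0; have [q aE] := mpoly_modX j r a; exists q.
rewrite {1}aE (_ : a \mPo _ = 0) ?add0r //; apply: mpoly_grid_eq0 => z.
rewrite comp_mpoly_meval -[RHS](a0 z); apply: meval_eq => i.
by rewrite tnth_mktuple; case: eqP => // _; rewrite mevalXU.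
Qed.

End Grid.

(** * The action of differential operators on [C(x, s) f^s] *)

Lemma quotient_ruleD (T : fieldType) (a b c d a' b' c' d' : T) :
  b != 0 -> d != 0 ->
  ((a' * d + a * d' + (c' * b + c * b')) * (b * d)
    - (a * d + c * b) * (b' * d + b * d')) / (b * d) ^+ 2 =
  (a' * b - a * b') / b ^+ 2 + (c' * d - c * d') / d ^+ 2.
Proof. by move=> b0 d0; field; rewrite b0 d0. Qed.

Lemma quotient_ruleM (T : fieldType) (a b c d a' b' c' d' : T) :
  b != 0 -> d != 0 ->
  ((a' * c + a * c') * (b * d) - a * c * (b' * d + b * d')) / (b * d) ^+ 2 =
  (a' * b - a * b') / b ^+ 2 * (c / d) + a / b * ((c' * d - c * d') / d ^+ 2).
Proof. by move=> b0 d0; field; rewrite b0 d0. Qed.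

Lemma submm (n : nat) (m : 'X_{1..n}) : (m - m = 0)%MM.
Proof. by apply/mnmP => i; rewrite mnmBE subnn mnm0E. Qed.

Section FracDeriv.

Variables (C : fieldType) (n p : nat).
Notation K := {fraction {mpoly C[n + p]}}.
Implicit Types (a b : {mpoly C[n + p]}) (g h : K).

Lemma frac_fractionP g : exists a b, b != 0 /\ g = a%:F / b%:F.
Proof.
exists (frac (repr g)).1, (frac (repr g)).2.
set u := (frac _).1; set v := (frac _).2.
have v0 : v != 0 by exact: denom_ratioP.
split=> //; apply/(mulIf (x := v%:F)); first by rewrite tofrac_eq0.
rewrite divfK ?tofrac_eq0 // -[g in LHS]reprK -[repr g in LHS]Ratio_numden.
unlock FracField.tofrac; rewrite -[LHS]FracField.pi_mul; apply/eqmodP => /=.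
rewrite FracField.equivfE /FracField.mulf !numden_Ratio ?mulf_neq0 ?oner_eq0 //.
by rewrite !mulr1 mulrC.
Qed.

Lemma frac_deriv_tofrac k a : frac_deriv k a%:F = (a^`M(lshift p k))%:F.
Proof.
rewrite -[a%:F]divr1 -tofrac1 frac_derivE ?oner_eq0 // -mpolyC1 mderivC.
by rewrite mulr0 subr0 mpolyC1 mulr1 expr1n tofrac1 divr1.
Qed.

Lemma frac_derivD k : {morph @frac_deriv C n p k : g h / g + h}.
Proof.
move=> g h; have [a [b [b0 ->]]] := frac_fractionP g.
have [c [d [d0 ->]]] := frac_fractionP h.
have B0 : b%:F != 0 :> K by rewrite tofrac_eq0.
have D0 : d%:F != 0 :> K by rewrite tofrac_eq0.
rewrite (addf_div _ _ B0 D0) -!tofracM -tofracD !frac_derivE ?mulf_neq0 //.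
rewrite mderivD !mderivM !(tofracXn, tofracB, tofracM, tofracD).
exact: (quotient_ruleD _ _ _ _ _ _ B0 D0).
Qed.

Lemma frac_derivM k g h :
  frac_deriv k (g * h) = frac_deriv k g * h + g * frac_deriv k h.
Proof.
have [a [b [b0 ->]]] := frac_fractionP g.
have [c [d [d0 ->]]] := frac_fractionP h.
have B0 : b%:F != 0 :> K by rewrite tofrac_eq0.
have D0 : d%:F != 0 :> K by rewrite tofrac_eq0.
rewrite (mulf_div a%:F) -!tofracM !frac_derivE ?mulf_neq0 //.
rewrite !mderivM !(tofracXn, tofracB, tofracM, tofracD).
exact: (quotient_ruleM _ _ _ _ _ _ B0 D0).
Qed.

Lemma frac_deriv0 k : frac_deriv k (0 : K) = 0.
Proof. by rewrite -tofrac0 frac_deriv_tofrac mderiv0 tofrac0. Qed.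

Lemma frac_deriv1 k : frac_deriv k (1 : K) = 0.
Proof. by rewrite -tofrac1 frac_deriv_tofrac -mpolyC1 mderivC tofrac0. Qed.

Lemma frac_deriv_sum k (I : Type) (r : seq I) (P : pred I) (G : I -> K) :
  frac_deriv k (\sum_(i <- r | P i) G i) = \sum_(i <- r | P i) frac_deriv k (G i).
Proof. exact: (big_morph _ (frac_derivD k) (frac_deriv0 k)). Qed.

(** Writing [g = a / b] and differentiating [g * b = a] twice expresses the iterated derivative
    through terms symmetric in [i] and [j]. *)
Lemma frac_deriv_comm i j g :
  frac_deriv i (frac_deriv j g) = frac_deriv j (frac_deriv i g).
Proof.
have [a [b [b0 gE]]] := frac_fractionP g.
have B0 : b%:F != 0 :> K by rewrite tofrac_eq0.
have ga : g * b%:F = a%:F by rewrite gE divfK.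
have E i' j' : frac_deriv i' (frac_deriv j' g) * b%:F =
    (a^`M(lshift p j')^`M(lshift p i'))%:F
    - frac_deriv j' g * (b^`M(lshift p i'))%:F
    - frac_deriv i' g * (b^`M(lshift p j'))%:F
    - g * (b^`M(lshift p j')^`M(lshift p i'))%:F.
  rewrite -!frac_deriv_tofrac -ga !(frac_derivM, frac_derivD); ring.
apply: (mulIf B0); rewrite !E [a^`M(_)^`M(_)]mderiv_comm.
by rewrite [b^`M(_)^`M(_)]mderiv_comm; ring.
Qed.

Lemma xpoly_deriv k (a : {mpoly C[n]}) :
  (xpoly p a)^`M(lshift p k) = xpoly p a^`M(k).
Proof.
rewrite /xpoly; elim/mpoly_ring_ind: a => [c|i|a b IHa IHb|a b IHa IHb].
- by rewrite comp_mpolyC !mderivC raddf0.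
- rewrite comp_mpolyXU -tnth_nth tnth_mktuple !mderivX comp_mpolyZ !mnm1E.
  rewrite (inj_eq (@lshift_inj _ _)); case: eqP => [->|_]; last by rewrite !scale0r.
  by rewrite !submm !mpolyX0 comp_mpoly1.
- by rewrite !raddfD /= IHa IHb.
- by rewrite rmorphM /= !mderivM IHa IHb raddfD /= !rmorphM.
Qed.

Lemma spoly_deriv k (b : {mpoly C[p]}) : (spoly n b)^`M(lshift p k) = 0.
Proof.
rewrite /spoly; elim/mpoly_ring_ind: b => [c|i|a b IHa IHb|a b IHa IHb].
- by rewrite comp_mpolyC mderivC.
- by rewrite comp_mpolyXU -tnth_nth tnth_mktuple mderivX mnm1E eq_rlshift scale0r.
- by rewrite !raddfD /= IHa IHb addr0.
- by rewrite rmorphM /= mderivM IHa IHb mul0r mulr0 addr0.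
Qed.

Lemma tofrac_xpoly_neq0 (a : {mpoly C[n]}) : a != 0 -> (xpoly p a)%:F != 0 :> K.
Proof. by rewrite tofrac_eq0 xpoly_eq0. Qed.

Section Twisted.

Variable f : 'I_p -> {mpoly C[n]}.
Hypothesis f_neq0 : forall i, f i != 0.

Definition dlog_symbol (k : 'I_n) : K :=
  \sum_(i < p)
    ('X_(rshift n i))%:F * ((xpoly p (f i)^`M(k))%:F / (xpoly p (f i))%:F).

Lemma fs_derivE k g : fs_deriv f k g = frac_deriv k g + g * dlog_symbol k.
Proof. by []. Qed.

Lemma fs_derivD k : {morph fs_deriv f k : g h / g + h}.
Proof. by move=> g h; rewrite !fs_derivE frac_derivD; ring. Qed.

Lemma fs_deriv0 k : fs_deriv f k 0 = 0.
Proof. by rewrite fs_derivE frac_deriv0 mul0r addr0. Qed.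

Lemma fs_derivM k h g :
  fs_deriv f k (h * g) = frac_deriv k h * g + h * fs_deriv f k g.
Proof. by rewrite !fs_derivE frac_derivM; ring. Qed.

(** Closedness of the form [sum_i s_i dlog f_i], the integrability condition that makes the
    operators [fs_deriv f k] commute. *)
Lemma dlog_symbol_closed i j :
  frac_deriv i (dlog_symbol j) = frac_deriv j (dlog_symbol i).
Proof.
rewrite /dlog_symbol !frac_deriv_sum; apply: eq_bigr => l _.
rewrite frac_derivM [RHS]frac_derivM !frac_deriv_tofrac !mderivX !mnm1E !eq_rlshift !scale0r.
rewrite !tofrac0 !mul0r !add0r; congr (_ * _).
by rewrite !frac_derivE ?xpoly_eq0 // !xpoly_deriv mderiv_comm [in X in _ - X]mulrC.
Qed.

Lemma fs_deriv_comm i j g :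
  fs_deriv f i (fs_deriv f j g) = fs_deriv f j (fs_deriv f i g).
Proof.
rewrite !fs_derivE !frac_derivD (frac_derivM i g) (frac_derivM j g).
by rewrite (frac_deriv_comm i) (dlog_symbol_closed i); ring.
Qed.

Lemma fs_deriv_iter_comm i j k g :
  fs_deriv f i (iter k (fs_deriv f j) g) = iter k (fs_deriv f j) (fs_deriv f i g).
Proof. by elim: k => //= k <-; rewrite fs_deriv_comm. Qed.

(** By commutation, a derivation applied last can be moved to its place in the fixed order of
    [enum 'I_n]; this keeps operators in normal form. *)
Lemma fs_derivmDU m k g :
  fs_derivm f (m + U_(k))%MM g = fs_deriv f k (fs_derivm f m g).
Proof.
have : k \in enum 'I_n by rewrite mem_enum.
rewrite /fs_derivm; elim: (enum _) (enum_uniq 'I_n) => //= i r IH /andP[ir ur].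
rewrite inE mnmDE mnm1E; case: (eqVneq k i) => [-> _ | _ /= kr].
  rewrite addn1 /=; congr (fs_deriv _ _ (iter _ _ _)).
  elim: r ir {IH ur} => //= j r IH; rewrite inE negb_or => /andP[ij ir].
  by rewrite IH // mnmDE mnm1E (negPf ij) addn0.
by rewrite addn0 IH // fs_deriv_iter_comm.
Qed.

(** A range of exponents independent of the support of [P] allows operators to be added termwise. *)
Lemma weyl_actwE d (P : {mpoly {mpoly C[n + p]}[n]}) g : (msize P <= d)%N ->
  weyl_act f P g = \sum_(m : 'X_{1..n < d}) (P@_m)%:F * fs_derivm f m g.
Proof.
move=> sP; rewrite /weyl_act.
pose F m : K := (P@_m)%:F * fs_derivm f m g.
pose I : subFinType _ := 'X_{1..n < d}.
rewrite -/(F _) (big_mksub I) ?msupp_uniq //=; first last.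
  by move=> x /msize_mdeg_lt /leq_trans; apply.
rewrite big_rmcond //= => m /memN_msupp_eq0 P0.
by rewrite /F P0 tofrac0 mul0r.
Qed.

(** The module [M], seen inside [C(x, s)]; [bernstein_ideal f b] is by definition membership of
    [(spoly n b)%:F] in it. *)
Definition weyl_module (g : K) : Prop :=
  exists P, g = weyl_act f P (\prod_(i < p) xpoly p (f i))%:F.

Lemma weyl_module_ind (W : K -> Prop) :
  W (\prod_(i < p) xpoly p (f i))%:F ->
  (forall g h, W g -> W h -> W (g + h)) ->
  (forall a g, W g -> W (a%:F * g)) ->
  (forall k g, W g -> W (fs_deriv f k g)) ->
  forall g, weyl_module g -> W g.
Proof.
move=> WF WD WM Wd g [P ->]; rewrite /weyl_act.
apply: big_ind => [||m _]; [|exact: WD|].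
  by rewrite -(mul0r (\prod_(i < p) xpoly p (f i))%:F) -tofrac0; apply: (WM).
apply: (WM); rewrite /fs_derivm.
elim: (enum _) => //= k r IH; elim: (m k) => //= d IHd; exact: Wd.
Qed.

Lemma weyl_module_gen : weyl_module (\prod_(i < p) xpoly p (f i))%:F.
Proof.
exists 1; rewrite /weyl_act msupp1 big_seq1 mcoeff1 eqxx tofrac1 mul1r.
by rewrite /fs_derivm; elim: (enum _) => //= i r <-; rewrite mnm0E.
Qed.

Lemma weyl_moduleD g h : weyl_module g -> weyl_module h -> weyl_module (g + h).
Proof.
move=> [P ->] [Q ->]; exists (P + Q).
set d := maxn (msize P) (msize Q).
rewrite !(@weyl_actwE d) ?leq_maxl ?leq_maxr ?msizeD_le //.
by rewrite -big_split; apply: eq_bigr => m _; rewrite mcoeffD tofracD mulrDl.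
Qed.

Lemma weyl_moduleM a g : weyl_module g -> weyl_module (a%:F * g).
Proof.
move=> [P ->]; exists (a *: P).
rewrite !(@weyl_actwE (msize P)) ?msizeZ_le // mulr_sumr.
by apply: eq_bigr => m _; rewrite mcoeffZ tofracM mulrA.
Qed.

Lemma weyl_module0 : weyl_module 0.
Proof.
rewrite -(mul0r (\prod_(i < p) xpoly p (f i))%:F) -tofrac0.
exact: weyl_moduleM weyl_module_gen.
Qed.

Lemma weyl_module_sum (I : Type) (r : seq I) (P : pred I) (G : I -> K) :
  (forall i, P i -> weyl_module (G i)) -> weyl_module (\sum_(i <- r | P i) G i).
Proof.
move=> HG; apply: big_ind => //; [exact: weyl_module0 | exact: weyl_moduleD].
Qed.

Lemma weyl_moduleN g : weyl_module g -> weyl_module (- g).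
Proof. by move=> /(weyl_moduleM (-1)); rewrite tofracN tofrac1 mulN1r. Qed.

Lemma weyl_module_monomial a m :
  weyl_module (a%:F * fs_derivm f m (\prod_(i < p) xpoly p (f i))%:F).
Proof.
apply: weyl_moduleM; exists 'X_[m].
by rewrite /weyl_act msuppX big_seq1 mcoeffX eqxx tofrac1 mul1r.
Qed.

(** The Leibniz rule [d_k P_m d^m = (d_k P_m) d^m + P_m d_k d^m] restores the normal form. *)
Lemma weyl_module_deriv k g : weyl_module g -> weyl_module (fs_deriv f k g).
Proof.
move=> [P ->]; rewrite /weyl_act.
rewrite (big_morph _ (fs_derivD k) (fs_deriv0 k)).
apply: weyl_module_sum => m _; rewrite fs_derivM frac_deriv_tofrac -fs_derivmDU.
by apply: weyl_moduleD; apply: weyl_module_monomial.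
Qed.

End Twisted.

End FracDeriv.

(** * Generic linear forms *)

Section GenericForms.

Variables (C : fieldType) (n : nat) (A : 'M[C]_(n.+1, n)).
Hypothesis generic : forall r : 'I_n -> 'I_n.+1, injective r ->
  \rank (rowsub r A) = n.

Lemma rowsub_lift_unit i : rowsub (lift i) A \in unitmx.
Proof. by rewrite -row_full_unit /row_full generic //; apply: lift_inj. Qed.

(** The [n + 1] rows are dependent, and a zero coefficient would leave a relation between [n] of
    them, against genericity. For the last clause, [n] of the equations are solved by inverting a
    square block, and the relation then forces the remaining one. *)
Lemma generic_relation : exists c : 'I_n.+1 -> C,
  [/\ forall i, c i != 0, forall k, \sum_i c i * A i k = 0 &
      forall u : 'I_n.+1 -> C, \sum_i c i * u i = 0 ->
        exists v : 'I_n -> C, forall i, \sum_k A i k * v k = u i].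
Proof.
have : kermx A != 0.
  by rewrite -mxrank_eq0 mxrank_ker -lt0n subn_gt0 ltnS rank_leq_col.
case/rowV0Pn => c /sub_kermxP cA c0.
have relA k : \sum_i c 0 i * A i k = 0.
  by move/rowP: cA => /(_ k); rewrite !mxE.
have ci0 i : c 0 i != 0.
  apply: contra_neq c0 => ci0.
  have : colsub (lift i) c *m rowsub (lift i) A = 0.
    apply/rowP => k; rewrite !mxE -[RHS](relA k) (bigD1_ord i) //= ci0 mul0r add0r.
    by apply: eq_bigr => j _; rewrite !mxE.
  rewrite -[RHS](mul0mx 1 (rowsub (lift i) A)).
  move/(can_inj (mulmxK (rowsub_lift_unit i)))/rowP => c'0.
  apply/rowP => j; rewrite mxE; case: (unliftP i j) => [j' ->|-> //].
  by have := c'0 j'; rewrite !mxE.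
exists (c 0); split=> // u cu.
pose v := invmx (rowsub (lift ord_max) A) *m \col_j u (lift ord_max j).
have Av j : \sum_k A (lift ord_max j) k * v k 0 = u (lift ord_max j).
  have := mulKVmx (rowsub_lift_unit ord_max) (\col_j u (lift ord_max j)).
  by move/colP/(_ j); rewrite !mxE => <-; apply: eq_bigr => k _; rewrite !mxE.
exists (fun k => v k 0) => i.
case: (unliftP ord_max i) => [j ->|->] //.
apply: (mulfI (ci0 ord_max)).
have : \sum_i c 0 i * (\sum_k A i k * v k 0) = 0.
  under eq_bigr do rewrite mulr_sumr.
  rewrite exchange_big big1 //= => k _.
  under eq_bigr do rewrite mulrA.
  by rewrite -mulr_suml relA mul0r.
rewrite -[RHS]cu (bigD1_ord ord_max) //= [RHS](bigD1_ord ord_max) //=.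
have -> : \sum_j c 0 (lift ord_max j) * (\sum_k A (lift ord_max j) k * v k 0) =
    \sum_j c 0 (lift ord_max j) * u (lift ord_max j).
  by apply: eq_bigr => j _; rewrite Av.
by move/addIr.
Qed.

Definition form (i : 'I_n.+1) : {mpoly C[n + n.+1]} := xpoly n.+1 (linear_form A i).

Lemma formE i : form i = \sum_k A i k *: 'X_(lshift n.+1 k).
Proof.
rewrite /form /xpoly /linear_form raddf_sum /=; apply: eq_bigr => k _.
by rewrite comp_mpolyZ comp_mpolyXU -tnth_nth tnth_mktuple.
Qed.

Lemma linear_form_deriv i k : (linear_form A i)^`M(k) = (A i k)%:MP.
Proof.
rewrite /linear_form raddf_sum (bigD1 k) //= big1 => [|j jk].
  by rewrite addr0 mderivZ mderivX mnm1E eqxx scale1r submm mpolyX0 alg_mpolyC.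
by rewrite mderivZ mderivX mnm1E (negPf jk) scale0r scaler0.
Qed.

Lemma form_deriv i k : (form i)^`M(lshift n.+1 k) = (A i k)%:MP.
Proof. by rewrite /form xpoly_deriv linear_form_deriv /xpoly comp_mpolyC. Qed.

Lemma linear_form_eval i v : (linear_form A i).@[v] = \sum_k A i k * v k.
Proof.
rewrite /linear_form raddf_sum /=; apply: eq_bigr => k _.
by rewrite mevalZ mevalXU.
Qed.

(** The constant vector field used to exchange [l_i]: the values [1] at [i], [- c i / c j] at [j]
    and [0] elsewhere satisfy the relation, so they are attained. *)
Lemma dual_vector i j : i != j -> exists v : 'I_n -> C,
  \sum_k A i k * v k = 1 /\
  forall m, m != i -> m != j -> \sum_k A m k * v k = 0.
Proof.
move=> ij; have [c [c0 _ surj]] := generic_relation.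
have [|v vE] := surj (fun m => if m == i then 1 else
                               if m == j then - (c i / c j) else 0).
  rewrite (bigD1 i) //= (bigD1 j) 1?eq_sym //= !eqxx eq_sym (negPf ij).
  rewrite big1 => [|m /andP[/negPf-> /negPf->]]; last by rewrite mulr0.
  by rewrite mulr1 addr0 mulrN mulrC divfK ?subrr.
exists v; split=> [|m mi mj]; rewrite vE ?eqxx //.
by rewrite (negPf mi) (negPf mj).
Qed.

Lemma linear_form_neq0 i : (0 < n)%N -> linear_form A i != 0.
Proof.
move=> n0; have [v [vi _]] := dual_vector (neq_lift i (Ordinal n0)).
apply: contraTneq (oner_neq0 C) => l0.
by rewrite -vi -linear_form_eval l0 meval0 eqxx.
Qed.

(** The form [l_i] is left out because an exchange of [l_i] multiplies by some [l_j] with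
    [j != i]. *)
Lemma var_in_span_forms (i : 'I_n.+1) : exists w : 'I_n -> 'I_n -> C, forall k,
  'X_(lshift n.+1 k) = \sum_j w k j *: form (lift i j).
Proof.
exists (fun k j => invmx (rowsub (lift i) A) k j) => k.
have E m : \sum_j invmx (rowsub (lift i) A) k j * A (lift i j) m = (k == m)%:R.
  have /matrixP/(_ k m) := mulVmx (rowsub_lift_unit i).
  by rewrite !mxE => <-; apply: eq_bigr => j _; rewrite !mxE.
under eq_bigr do rewrite formE scaler_sumr.
rewrite exchange_big /= [LHS](_ : _ = \sum_m (k == m)%:R *: 'X_(lshift n.+1 m)).
  apply: eq_bigr => m _; rewrite -E scaler_suml.
  by apply: eq_bigr => j _; rewrite scalerA.
rewrite (bigD1 k) //= eqxx scale1r big1 ?addr0 // => m /negPf.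
by rewrite eq_sym => ->; rewrite scale0r.
Qed.

(** The power [m^d] of the ideal [(x_1, ..., x_n)] of [C[x, s]], through the recursion
    [m^(d+1) = sum_i x_i m^d]. *)
Fixpoint in_mpow (d : nat) (a : {mpoly C[n + n.+1]}) : Prop :=
  if d is d'.+1 then
    exists b, (forall i, in_mpow d' (b i)) /\ a = \sum_i 'X_(lshift n.+1 i) * b i
  else True.

Lemma in_mpow0 d : in_mpow d 0.
Proof.
elim: d => //= d IH; exists (fun=> 0); split=> //.
by rewrite big1 // => i _; rewrite mulr0.
Qed.

Lemma in_mpowD d a b : in_mpow d a -> in_mpow d b -> in_mpow d (a + b).
Proof.
elim: d a b => //= d IH a b [a' [a'd ->]] [b' [b'd ->]].
exists (fun i => a' i + b' i); split=> [i|]; first exact: IH.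
by rewrite -big_split; apply: eq_bigr => i _; rewrite mulrDr.
Qed.

Lemma in_mpowM d c a : in_mpow d a -> in_mpow d (c * a).
Proof.
elim: d a => //= d IH a [a' [a'd ->]].
exists (fun i => c * a' i); split=> [i|]; first exact: IH.
by rewrite mulr_sumr; apply: eq_bigr => i _; rewrite mulrCA.
Qed.

Lemma in_mpow_sum d (I : Type) (r : seq I) (P : pred I) F :
  (forall i, P i -> in_mpow d (F i)) -> in_mpow d (\sum_(i <- r | P i) F i).
Proof.
by move=> HF; apply: big_ind => //; [exact: in_mpow0 | exact: in_mpowD].
Qed.

Lemma in_mpowX d i a : in_mpow d a -> in_mpow d.+1 ('X_(lshift n.+1 i) * a).
Proof.
move=> ad /=; exists (fun j => if j == i then a else 0); split=> [j|].
  by case: eqP => // _; apply: in_mpow0.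
rewrite (bigD1 i) //= eqxx big1 ?addr0 // => j /negPf->.
by rewrite mulr0.
Qed.

Lemma in_mpow_form d i a : in_mpow d a -> in_mpow d.+1 (form i * a).
Proof.
move=> ad; rewrite formE mulr_suml; apply: in_mpow_sum => k _.
by rewrite -mul_mpolyC -mulrA; apply: in_mpowM; apply: in_mpowX.
Qed.

Lemma var_deriv i k : ('X_(lshift n.+1 i) : {mpoly C[n + n.+1]})^`M(lshift n.+1 k)
  = (i == k)%:R.
Proof.
rewrite mderivX mnm1E (inj_eq (@lshift_inj _ _)); case: eqP => [->|_].
  by rewrite scale1r submm mpolyX0.
by rewrite scale0r.
Qed.

Lemma in_mpow_deriv d k a : in_mpow d.+1 a -> in_mpow d a^`M(lshift n.+1 k).
Proof.
elim: d a => // d IH a [b [bd ->]]; rewrite raddf_sum; apply: in_mpow_sum => i _.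
rewrite [X in in_mpow _ X]mderivM var_deriv.
apply: in_mpowD; first by apply: in_mpowM; exact: bd.
by apply: (@in_mpowX d); apply: IH; exact: bd.
Qed.

(** The Euler operator [E] acts on [m^d / m^(d+1)] as multiplication by [d]; the induction rests on
    [E (x_i b) - (d + 1) x_i b = x_i (E b - d b)]. *)
Lemma in_mpow_euler d a : in_mpow d a ->
  in_mpow d.+1 (\sum_k 'X_(lshift n.+1 k) * a^`M(lshift n.+1 k) - a *+ d).
Proof.
elim: d a => [a _|d IH a [b [bd ->]]].
  by rewrite mulr0n subr0; apply: in_mpow_sum => k _; apply: (@in_mpowX 0).
rewrite (_ : _ - _ = \sum_i 'X_(lshift n.+1 i) *
   (\sum_k 'X_(lshift n.+1 k) * (b i)^`M(lshift n.+1 k) - b i *+ d)).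
  by apply: in_mpow_sum => i _; apply: in_mpowX; apply: IH; exact: bd.
rewrite (eq_bigr (fun k => \sum_i ('X_(lshift n.+1 k) * ((i == k)%:R * b i) +
    'X_(lshift n.+1 k) * ('X_(lshift n.+1 i) * (b i)^`M(lshift n.+1 k))))).
  rewrite exchange_big -sumrMnl -sumrB; apply: eq_bigr => i _ /=.
  rewrite big_split /= (bigD1 i) //= eqxx mul1r big1 => [|k].
    rewrite addr0; under eq_bigr do rewrite mulrCA.
    rewrite -mulr_sumr mulrS opprD addrACA subrr add0r mulrBr.
    by rewrite -mulrnAr.
  by rewrite eq_sym => /negPf->; rewrite mul0r mulr0.
move=> k _; rewrite raddf_sum mulr_sumr; apply: eq_bigr => i _ /=.
by rewrite mderivM var_deriv mulrDr.
Qed.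

Definition dir_deriv (v : 'I_n -> C) (a : {mpoly C[n + n.+1]}) :=
  \sum_k v k *: a^`M(lshift n.+1 k).

Lemma dir_derivM v a b : dir_deriv v (a * b) = dir_deriv v a * b + a * dir_deriv v b.
Proof.
rewrite /dir_deriv mulr_suml mulr_sumr -big_split; apply: eq_bigr => k _ /=.
by rewrite mderivM scalerDr scalerAl scalerAr.
Qed.

Lemma dir_deriv_form v i : dir_deriv v (form i) = (\sum_k A i k * v k)%:MP.
Proof.
rewrite /dir_deriv raddf_sum; apply: eq_bigr => k _ /=.
by rewrite form_deriv mulrC mpolyCM mul_mpolyC.
Qed.

Lemma dir_deriv_prod0 v (P : pred 'I_n.+1) :
  (forall i, P i -> \sum_k A i k * v k = 0) ->
  dir_deriv v (\prod_(i | P i) form i) = 0.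
Proof.
move=> v0; apply: (big_ind (fun a => dir_deriv v a = 0)) => [|a b a0 b0|i /v0 vi].
- by rewrite /dir_deriv big1 // => k _; rewrite -mpolyC1 mderivC scaler0.
- by rewrite dir_derivM a0 b0 mul0r mulr0 addr0.
- by rewrite dir_deriv_form vi.
Qed.

Lemma dir_deriv_spoly v b : dir_deriv v (spoly n b) = 0.
Proof. by rewrite /dir_deriv big1 // => k _; rewrite spoly_deriv scaler0. Qed.

Lemma in_mpow_dir_deriv d v i a :
  in_mpow d a -> in_mpow d (form i * dir_deriv v a).
Proof.
case: d => // d ad; apply: in_mpow_form; apply: in_mpow_sum => k _.
by rewrite -mul_mpolyC; apply: in_mpowM; apply: in_mpow_deriv.
Qed.

End GenericForms.

(** * Membership *)

Section Membership.

Variables (C : fieldType) (n : nat) (A : 'M[C]_(n.+1, n)).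
Hypothesis n_gt0 : (0 < n)%N.
Hypothesis generic : forall r : 'I_n -> 'I_n.+1, injective r ->
  \rank (rowsub r A) = n.

Local Notation R := {mpoly C[n + n.+1]}.
Local Notation M a := (weyl_module (linear_form A) (a : R)%:F).
Local Notation lf := (form A).
Local Notation s i := ('X_(rshift n i) : R).

Lemma form_neq0 i : lf i != 0.
Proof. by rewrite xpoly_eq0 linear_form_neq0. Qed.

Lemma fs_deriv_tofrac k (a : R) : fs_deriv (linear_form A) k a%:F =
  (a^`M(lshift n.+1 k))%:F + \sum_i (s i)%:F * ((A i k *: a)%:F / (lf i)%:F).
Proof.
rewrite fs_derivE frac_deriv_tofrac; congr (_ + _).
rewrite /dlog_symbol mulr_sumr; apply: eq_bigr => i _.
rewrite linear_form_deriv /xpoly comp_mpolyC -mul_mpolyC mulrC.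
by rewrite [(_ * a)%:F]tofracM -!mulrA; congr (_ * (_ * _)); rewrite mulrC.
Qed.

(** The element [sum_k d_k (a_k f^s)] has a pole [s_i (sum_k A i k a_k) / l_i] for each [i];
    multiplication by [h] clears these poles, with quotients [q i]. *)
Lemma weyl_module_div (h : R) (a : 'I_n -> R) (q : 'I_n.+1 -> R) :
  (forall k, M (a k)) ->
  (forall i, h * (\sum_k A i k *: a k) = q i * lf i) ->
  M (h * (\sum_k (a k)^`M(lshift n.+1 k)) + \sum_i s i * q i).
Proof.
move=> Ma hq.
have -> : (h * (\sum_k (a k)^`M(lshift n.+1 k)) + \sum_i s i * q i)%:F =
    h%:F * \sum_k fs_deriv (linear_form A) k (a k)%:F.
  under [in RHS]eq_bigr do rewrite fs_deriv_tofrac.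
  rewrite big_split /= mulrDr -raddf_sum -tofracM tofracD; congr (_ + _).
  rewrite exchange_big mulr_sumr raddf_sum; apply: eq_bigr => i _ /=.
  rewrite -mulr_sumr -mulr_suml -raddf_sum mulrCA [h%:F * _]mulrA -tofracM.
  by rewrite hq !tofracM mulfK // tofrac_eq0 form_neq0.
apply: weyl_moduleM; apply: weyl_module_sum => k _.
apply: weyl_module_deriv => // i; exact: linear_form_neq0.
Qed.

Local Notation G P := (\prod_(j < n.+1 | P j) lf j).
Local Notation S P := (\prod_(j < n.+1 | P j) (s j + 1)).

(** [K] records the forms already exchanged for factors [s_j + 1]. *)
Definition in_colon (K : {set 'I_n.+1}) (a : R) :=
  M (\prod_(j in K) (s j + 1) * a * \prod_(j in ~: K) lf j).

Lemma weyl_module_polyD (a b : R) : M a -> M b -> M (a + b).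
Proof. by rewrite tofracD; apply: weyl_moduleD. Qed.

Lemma weyl_module_polyM (a b : R) : M b -> M (a * b).
Proof. by rewrite tofracM; apply: weyl_moduleM. Qed.

(** The vector field [v] of [dual_vector] is applied to [X f^s], where [X = P * a * G], and the
    result is multiplied by [l_j]. Besides the wanted term there remain multiples of [X] and the
    term of [l_j v(a)]. The latter is again in [m^d], which is why the hypothesis bears on all of
    [m^d] and not on [a] alone. *)
Lemma in_colon_step (K : {set 'I_n.+1}) i j d a : i != j -> i \notin K ->
  (forall b, in_mpow d b -> in_colon K b) -> in_mpow d a ->
  in_colon (i |: K) (lf j * a).
Proof.
move=> ij iK colK da; have [v [vi vm]] := dual_vector generic ij.
set kappa := \sum_k A j k * v k.
pose P : R := \prod_(m in K) (s m + 1).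
pose G : R := \prod_(m in ~: K) lf m.
pose G' : R := \prod_(m in ~: (i |: K)) lf m.
have GE : G = lf i * G'.
  rewrite /G (bigD1 i) ?inE //=; congr (_ * _); apply: eq_bigl => m.
  by rewrite !inE negb_or andbC.
(* Among the factors of [G'] only [l_j] can have a nonzero derivative along [v], and it occurs
   exactly when [j] is not in [K]. *)
have dG' : lf j * dir_deriv v G' = kappa *: (if j \in K then 0 else G').
  have dG0 (Q : pred 'I_n.+1) : ~~ Q i -> ~~ Q j ->
      dir_deriv v (\prod_(m | Q m) lf m) = 0.
    move=> Qi Qj; apply: dir_deriv_prod0 => m Qm.
    by apply: vm; [apply: contraNneq Qi | apply: contraNneq Qj] => <-.
  case: ifP => jK; first by rewrite dG0 ?mulr0 ?scaler0 // !inE ?eqxx // jK orbT.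
  rewrite /G' (bigD1 j) /=; last by rewrite !inE jK eq_sym (negPf ij).
  rewrite dir_derivM dir_deriv_form dG0 ?inE ?eqxx ?andbF //.
  by rewrite mulr0 addr0 mulrCA mul_mpolyC.
have dP : dir_deriv v P = 0.
  rewrite (_ : P = spoly n (\prod_(m in K) ('X_m + 1))) ?dir_deriv_spoly //.
  rewrite /spoly rmorph_prod; apply: eq_bigr => m _ /=.
  by rewrite rmorphD rmorph1 /= comp_mpolyXU -tnth_nth tnth_mktuple.
pose X := P * a * G.
have MX : M X by exact: colK.
(* The quotients [l_j v(l_m) X / l_m], which vanish unless [m] is [i] or [j]. *)
pose q m := if m == i then P * a * G' * lf j else if m == j then kappa *: X else 0.
have dX : lf j * dir_deriv v X = P * (lf j * dir_deriv v a) * G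
    + P * (lf j * a) * G' + (if j \in K then 0 else kappa *: X).
  rewrite /X !dir_derivM dP GE dir_derivM dir_deriv_form vi.
  rewrite (_ : _ * _ = P * (lf j * dir_deriv v a) * (lf i * G')
    + P * a * (lf j * G' + lf i * (lf j * dir_deriv v G'))); last by ring.
  rewrite dG'; case: ifP => _; first by rewrite scaler0; ring.
  by rewrite -!mul_mpolyC; ring.
have colE : P * (s i + 1) * (lf j * a) * G' =
    (lf j * dir_deriv v X + \sum_m s m * q m) - P * (lf j * dir_deriv v a) * G
    - kappa *: (s j + (j \notin K)%:R) * X.
  rewrite dX (bigD1 i) //= (bigD1 j) 1?eq_sym //= /q eqxx eq_sym (negPf ij) eqxx.
  rewrite big1 => [|m /andP[/negPf-> /negPf->]]; last by rewrite mulr0.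
  rewrite -!mul_mpolyC; case: (j \in K) => /=; ring.
rewrite /in_colon big_setU1 //= [(s i + 1) * _]mulrC colE.
apply: weyl_module_polyD; last first.
  rewrite -mulNr; exact: weyl_module_polyM.
apply: weyl_module_polyD; last first.
  by rewrite tofracN; apply: weyl_moduleN; apply: colK; apply: in_mpow_dir_deriv.
rewrite (_ : dir_deriv v X = \sum_k (v k *: X)^`M(lshift n.+1 k)); last first.
  by apply: eq_bigr => k _; rewrite mderivZ.
apply: weyl_module_div => [k|m].
  by rewrite -mul_mpolyC; apply: weyl_module_polyM.
under eq_bigr do rewrite scalerA.
rewrite -scaler_suml /q; case: eqVneq => [->|mi].
  by rewrite vi scale1r /X GE; ring.
case: eqVneq => [->|mj]; first by rewrite mulrC.
by rewrite vm // scale0r mulr0 mul0r.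
Qed.

(** Induction on the cardinal of [K]: for [i] in [K], one coordinate of each product is written in
    the forms other than [l_i], and [in_colon_step] exchanges [l_i] against each of them. *)
Lemma in_colon_mpow (K : {set 'I_n.+1}) a : in_mpow #|K| a -> in_colon K a.
Proof.
move: {2}#|K| (erefl #|K|) => d; elim: d K a => [K a /eqP|d IH K a cK].
  rewrite cards_eq0 => /eqP-> _.
  rewrite /in_colon big_set0 mul1r setC0; apply: weyl_module_polyM.
  rewrite (_ : \prod_(j in _) _ = \prod_j lf j); first exact: weyl_module_gen.
  by apply: eq_bigl => j; rewrite inE.
have /card_gt0P[i iK] : (0 < #|K|)%N by rewrite cK.
have cK' : #|K :\ i| = d by move: cK; rewrite (cardsD1 i) iK => -[].
rewrite cK -(setD1K iK) => -[b [bd ->]].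
have [w wE] := var_in_span_forms generic i.
have colD x y : in_colon (i |: K :\ i) x -> in_colon (i |: K :\ i) y ->
    in_colon (i |: K :\ i) (x + y).
  by rewrite /in_colon mulrDr mulrDl; apply: weyl_module_polyD.
have colM x y : in_colon (i |: K :\ i) y -> in_colon (i |: K :\ i) (x * y).
  rewrite /in_colon mulrCA => /(weyl_module_polyM x).
  by congr (M _); rewrite !mulrA.
have col0 : in_colon (i |: K :\ i) 0.
  by rewrite /in_colon mulr0 mul0r tofrac0; apply: weyl_module0.
apply: big_ind => // k _; rewrite wE mulr_suml; apply: big_ind => // j _.
rewrite -mul_mpolyC -mulrA; apply: colM.
apply: (@in_colon_step _ _ _ d); rewrite ?neq_lift ?setD11 //; last exact: bd.
by rewrite -cK' => x; apply: IH.
Qed.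

Lemma weyl_module_mpow a :
  in_mpow n.+1 a -> M (\prod_(j < n.+1) (s j + 1) * a).
Proof.
have := @in_colon_mpow setT a; rewrite cardsT card_ord /in_colon setCT.
rewrite big_set0 mulr1 => H /H; rewrite (_ : \prod_(j in _) _ = S xpredT) //.
by apply: eq_bigl => j; rewrite inE.
Qed.

(** Applying [sum_k d_k x_k] to [a f^s] gives [(S + n) a + E a] with [E] the Euler operator, and
    [E a] may be replaced by [d a] modulo [M]. *)
Lemma weyl_module_euler (a : R) (d : nat) : (forall k, M ('X_(lshift n.+1 k) * a)) ->
  M (\sum_k 'X_(lshift n.+1 k) * a^`M(lshift n.+1 k) - a *+ d) ->
  M ((\sum_j s j + (n + d)%:R) * a).
Proof.
move=> Ma Ed.
rewrite (_ : _ * a = 1 * (\sum_k ('X_(lshift n.+1 k) * a)^`M(lshift n.+1 k))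
   + \sum_i s i * a
   - (\sum_k 'X_(lshift n.+1 k) * a^`M(lshift n.+1 k) - a *+ d)); last first.
  rewrite (eq_bigr (fun k => a + 'X_(lshift n.+1 k) * a^`M(lshift n.+1 k))).
    rewrite big_split /= sumr_const card_ord natrD mulrDl mulr_suml.
    by rewrite -[a *+ n]mulr_natl -[a *+ d]mulr_natl; ring.
  by move=> k _; rewrite mderivM var_deriv eqxx mul1r.
apply: weyl_module_polyD; last by rewrite tofracN; apply: weyl_moduleN.
apply: weyl_module_div => // i; rewrite mul1r formE mulr_sumr.
by apply: eq_bigr => k _; rewrite scalerAl mulrC.
Qed.

Definition poly_bernstein : {mpoly C[n.+1]} :=
  \prod_(j < n.+1) ('X_j + 1) * \prod_(k < n.+1) (\sum_(j < n.+1) 'X_j + (n + k)%:R).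

Lemma spoly_X j : spoly n ('X_j : {mpoly C[n.+1]}) = s j.
Proof. by rewrite /spoly comp_mpolyXU -tnth_nth tnth_mktuple. Qed.

Lemma mem_poly_bernstein : bernstein_ideal (linear_form A) poly_bernstein.
Proof.
pose c (d : nat) : {mpoly C[n.+1]} := \prod_(j < n.+1) ('X_j + 1) *
  \prod_(d <= k < n.+1) (\sum_(j < n.+1) 'X_j + (n + k)%:R).
(* After [d] descents the factors with [k >= n + 1 - d] have been spent and [a] is only required to
   lie in [m^(n+1-d)]; the case [d = n + 1], [a = 1] is the goal. *)
have cM d a : (d <= n.+1)%N -> in_mpow (n.+1 - d) a ->
    M (spoly n (c (n.+1 - d)%N) * a).
  elim: d a => [a _|d IH a dn da].
    rewrite subn0 => /weyl_module_mpow; rewrite /c big_geq // mulr1.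
    congr (M (_ * a)); rewrite /spoly rmorph_prod; apply: eq_bigr => j _ /=.
    by rewrite rmorphD rmorph1 /= -spoly_X.
  set e := (n.+1 - d.+1)%N in da *.
  have eE : (n.+1 - d = e.+1)%N by rewrite /e subnSK.
  have cE : c e = (\sum_(j < n.+1) 'X_j + (n + e)%:R) * c e.+1.
    by rewrite /c [in LHS]big_ltn 1?mulrCA // /e ltnS subSS leq_subr.
  have sE : spoly n (c e) = (\sum_j s j + (n + e)%:R) * spoly n (c e.+1).
    rewrite cE /spoly rmorphM rmorphD rmorph_nat raddf_sum /=.
    by congr ((_ + _) * _); apply: eq_bigr => j _; apply: spoly_X.
  (* Both [x_k a] and [E a - e a] lie in [m^(e+1)], so the induction hypothesis covers both
     premises. *)
  rewrite sE -mulrA; apply: weyl_module_euler => [k|].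
    rewrite mulrCA -eE; apply: IH; first exact: ltnW.
    by rewrite eE; apply: in_mpowX.
  rewrite (_ : _ - _ = spoly n (c e.+1) *
     (\sum_k 'X_(lshift n.+1 k) * a^`M(lshift n.+1 k) - a *+ e)).
    by rewrite -eE; apply: IH; [exact: ltnW | rewrite eE; apply: in_mpow_euler].
  rewrite mulrBr mulr_sumr mulrnAr; congr (_ - _); apply: eq_bigr => k _.
  by rewrite mderivM spoly_deriv mul0r add0r mulrCA.
have := cM n.+1 1 (leqnn _); rewrite subnn => /(_ I); rewrite mulr1.
by rewrite /c big_mkord.
Qed.

End Membership.

(** * Specialization of the [s_j] *)

Lemma tofrac_div_eq (D : idomainType) (a b c d : D) : b != 0 -> d != 0 ->
  (a%:F / b%:F == c%:F / d%:F) = (a * d == c * b).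
Proof. by move=> b0 d0; rewrite eqr_div ?tofrac_eq0 // -!tofracM tofrac_eq. Qed.

Lemma tofrac_div_add (D : idomainType) (a b c d : D) : b != 0 -> d != 0 ->
  a%:F / b%:F + c%:F / d%:F = (a * d + c * b)%:F / (b * d)%:F.
Proof. by move=> b0 d0; rewrite addf_div ?tofrac_eq0 // tofracD !tofracM. Qed.

Lemma tofrac_div_mul (D : idomainType) (a b c d : D) :
  (a%:F / b%:F) * (c%:F / d%:F) = (a * c)%:F / (b * d)%:F.
Proof. by rewrite mulf_div !tofracM. Qed.

Section Specialization.

Variables (C : fieldType) (n p : nat) (f : 'I_p -> {mpoly C[n]}).
Hypothesis f_neq0 : forall i, f i != 0.
Notation R := {mpoly C[n + p]}.
Notation K := {fraction {mpoly C[n + p]}}.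

Variable z : 'I_p -> C.

(** The values stay in [R], so that [xpoly], [frac_deriv] and the fraction field are shared with the
    generic situation. *)
Definition specialize : R -> R := comp_mpoly
  [tuple if split i is inr j then (z j)%:MP else 'X_i | i < n + p].

HB.instance Definition _ := GRing.RMorphism.on specialize.

Lemma specialize_x k : specialize 'X_(lshift p k) = 'X_(lshift p k).
Proof.
rewrite /specialize comp_mpolyXU -tnth_nth tnth_mktuple.
by rewrite -[lshift p k]/(unsplit (inl k)) unsplitK.
Qed.

Lemma specialize_s j : specialize 'X_(rshift n j) = (z j)%:MP.
Proof.
rewrite /specialize comp_mpolyXU -tnth_nth tnth_mktuple.
by rewrite -[rshift n j]/(unsplit (inr j)) unsplitK.
Qed.

Lemma specializeD : {morph specialize : a b / a + b}.
Proof. exact: rmorphD. Qed.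

Lemma specializeM : {morph specialize : a b / a * b}.
Proof. exact: rmorphM. Qed.

Lemma specializeB : {morph specialize : a b / a - b}.
Proof. exact: rmorphB. Qed.

Lemma specializeXn m : {morph specialize : a / a ^+ m}.
Proof. exact: rmorphXn. Qed.

Lemma specializeC c : specialize c%:MP = c%:MP.
Proof. exact: comp_mpolyC. Qed.

Lemma specialize_xpoly a : specialize (xpoly p a) = xpoly p a.
Proof.
rewrite /xpoly; elim/mpoly_ring_ind: a => [c|i|a b IHa IHb|a b IHa IHb].
- by rewrite comp_mpolyC specializeC.
- by rewrite comp_mpolyXU -tnth_nth tnth_mktuple specialize_x.
- by rewrite !rmorphD /= IHa IHb.
- by rewrite !rmorphM /= IHa IHb.
Qed.

Lemma specialize_spoly b : specialize (spoly n b) = (b.@[z])%:MP.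
Proof.
rewrite /spoly; elim/mpoly_ring_ind: b => [c|i|a b IHa IHb|a b IHa IHb].
- by rewrite comp_mpolyC specializeC mevalC.
- by rewrite comp_mpolyXU -tnth_nth tnth_mktuple specialize_s mevalXU.
- by rewrite !rmorphD /= IHa IHb.
- by rewrite !rmorphM /= IHa IHb.
Qed.

Lemma specialize_deriv k a :
  specialize a^`M(lshift p k) = (specialize a)^`M(lshift p k).
Proof.
elim/mpoly_ring_ind: a => [c|i|a b IHa IHb|a b IHa IHb].
- by rewrite specializeC !mderivC raddf0.
- case: (split_ordP i) => j ->.
    rewrite specialize_x mderivX mnm1E (inj_eq (@lshift_inj _ _)).
    case: eqP => [->|_]; last by rewrite !scale0r raddf0.
    by rewrite !scale1r submm mpolyX0 rmorph1.
  by rewrite specialize_s mderivC mderivX mnm1E eq_rlshift scale0r raddf0.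
- by rewrite !raddfD /= IHa IHb.
- by rewrite specializeM !mderivM specializeD !specializeM IHa IHb.
Qed.

(** A relation and not a function: only fractions having a denominator that survives [s = z] can be
    specialized. The value is unique by [local_value_uniq]. *)
Definition local_value (g u : K) : Prop := exists a q,
  [/\ specialize q != 0, g = a%:F / q%:F & u = (specialize a)%:F / (specialize q)%:F].

Lemma specialize_neq0 q : specialize q != 0 -> q != 0.
Proof. by apply: contraNneq => ->; rewrite raddf0. Qed.

Lemma local_value_div a q : specialize q != 0 ->
  local_value (a%:F / q%:F) ((specialize a)%:F / (specialize q)%:F).
Proof. by exists a, q. Qed.

Lemma local_value_tofrac a : local_value a%:F (specialize a)%:F.
Proof.
have := @local_value_div a 1; rewrite !rmorph1 !divr1.
by apply; rewrite oner_eq0.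
Qed.

Lemma local_value_uniq g u v : local_value g u -> local_value g v -> u = v.
Proof.
move=> [a [q [q0 -> ->]]] [b [r [r0 E ->]]].
have [q1 r1] := (specialize_neq0 q0, specialize_neq0 r0).
apply/eqP; rewrite tofrac_div_eq //; move/eqP: E.
by rewrite tofrac_div_eq // -!specializeM => /eqP->.
Qed.

Lemma local_valueD g u h v :
  local_value g u -> local_value h v -> local_value (g + h) (u + v).
Proof.
move=> [a [q [q0 -> ->]]] [b [r [r0 -> ->]]].
have [q1 r1] := (specialize_neq0 q0, specialize_neq0 r0).
exists (a * r + b * q), (q * r).
by split; rewrite ?specializeD ?specializeM ?mulf_neq0 ?tofrac_div_add.
Qed.

Lemma local_valueM g u h v :
  local_value g u -> local_value h v -> local_value (g * h) (u * v).
Proof.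
move=> [a [q [q0 -> ->]]] [b [r [r0 -> ->]]].
exists (a * b), (q * r).
by split; rewrite ?specializeM ?mulf_neq0 ?tofrac_div_mul.
Qed.

Lemma local_value_sum (I : Type) (r : seq I) (G H : I -> K) :
  (forall i, local_value (G i) (H i)) ->
  local_value (\sum_(i <- r) G i) (\sum_(i <- r) H i).
Proof.
move=> GH; elim: r => [|i r IH]; last by rewrite !big_cons; apply: local_valueD.
by rewrite !big_nil; have := local_value_tofrac 0; rewrite !raddf0.
Qed.

Lemma local_value_deriv k g u :
  local_value g u -> local_value (frac_deriv k g) (frac_deriv k u).
Proof.
move=> [a [q [q0 -> ->]]].
rewrite (frac_derivE k a (specialize_neq0 q0)) (frac_derivE k (specialize a) q0).
rewrite -!specialize_deriv -!specializeM -specializeB -specializeXn.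
by apply: local_value_div; rewrite specializeXn expf_neq0.
Qed.

Variable w : K.
Hypothesis w_deriv : forall k, frac_deriv k w = w * \sum_(i < p)
  (z i)%:MP%:F * ((xpoly p (f i)^`M(k))%:F / (xpoly p (f i))%:F).

(** By [w_deriv], [w] behaves as [f^z], and sending [g f^s] to [g(z) w] turns [fs_deriv] into
    [frac_deriv]. Hence the elements whose value times [w] lies in [V] satisfy the closure
    properties of [weyl_module_ind]. *)
Lemma bernstein_specialize (V : K -> Prop) (b : {mpoly C[p]}) :
  (forall g h, V g -> V h -> V (g + h)) ->
  (forall a g, V g -> V (a%:F * g)) ->
  (forall k g, V g -> V (frac_deriv k g)) ->
  V ((\prod_(i < p) xpoly p (f i))%:F * w) ->
  bernstein_ideal f b -> V ((b.@[z])%:MP%:F * w).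
Proof.
move=> VD VM Vd VF Bb.
pose W g := exists2 u, local_value g u & V (u * w).
suff [u gu Vu] : W (spoly n b)%:F.
  by rewrite -specialize_spoly -(local_value_uniq gu (local_value_tofrac _)).
apply: weyl_module_ind Bb => [|g h [u gu Vu] [v hv Vv]|a g [u gu Vu]|k g [u gu Vu]].
- exists (\prod_(i < p) xpoly p (f i))%:F => //.
  have := local_value_tofrac (\prod_(i < p) xpoly p (f i)).
  rewrite (_ : specialize _ = \prod_(i < p) xpoly p (f i)) //.
  rewrite (rmorph_prod specialize); apply: eq_bigr => i _; exact: specialize_xpoly.
- by exists (u + v); [exact: local_valueD | rewrite mulrDl; exact: VD].
- exists ((specialize a)%:F * u); last by rewrite -mulrA; apply: VM.
  exact: local_valueM (local_value_tofrac a) gu.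
- exists (frac_deriv k u + u * \sum_(i < p)
     (z i)%:MP%:F * ((xpoly p (f i)^`M(k))%:F / (xpoly p (f i))%:F)).
    apply: local_valueD; first exact: local_value_deriv.
    apply: local_valueM => //; apply: local_value_sum => i.
    rewrite -specialize_s; apply: local_valueM; first exact: local_value_tofrac.
    have := @local_value_div (xpoly p (f i)^`M(k)) (xpoly p (f i)).
    by rewrite !specialize_xpoly xpoly_eq0; apply.
  suff -> : (frac_deriv k u + u * \sum_(i < p) (z i)%:MP%:F *
      ((xpoly p (f i)^`M(k))%:F / (xpoly p (f i))%:F)) * w =
      frac_deriv k (u * w) by apply: Vd.
  by rewrite frac_derivM w_deriv mulrDl [w * _]mulrC mulrA.
Qed.

End Specialization.

(** * Products of integer powers of the [f_i] *)

Section PowerSymbol.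

Variables (C : fieldType) (n p : nat).
Notation K := {fraction {mpoly C[n + p]}}.

Definition log_deriv (k : 'I_n) (g c : K) : Prop := frac_deriv k g = g * c.

Lemma log_derivM k g c h d :
  log_deriv k g c -> log_deriv k h d -> log_deriv k (g * h) (c + d).
Proof. by rewrite /log_deriv => gc hd; rewrite frac_derivM gc hd; ring. Qed.

Lemma log_deriv1 k : log_deriv k 1 0.
Proof. by rewrite /log_deriv frac_deriv1 mulr0. Qed.

Lemma log_derivX k g c m : log_deriv k g c -> log_deriv k (g ^+ m) (c *+ m).
Proof.
move=> gc; elim: m => [|m IH]; first by rewrite expr0 mulr0n; apply: log_deriv1.
by rewrite exprS mulrS; apply: log_derivM.
Qed.

Lemma log_deriv_prod k (I : Type) (r : seq I) (G c : I -> K) :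
  (forall i, log_deriv k (G i) (c i)) ->
  log_deriv k (\prod_(i <- r) G i) (\sum_(i <- r) c i).
Proof.
move=> Gc; elim: r => [|i r IH]; first by rewrite !big_nil; apply: log_deriv1.
by rewrite !big_cons; apply: log_derivM.
Qed.

Lemma log_derivV k g c : g != 0 -> log_deriv k g c -> log_deriv k g^-1 (- c).
Proof.
rewrite /log_deriv => g0 gc; apply: (mulfI g0).
have /eqP := @frac_deriv1 C n p k; rewrite -(mulfV g0) frac_derivM gc addrC addr_eq0.
by move/eqP=> ->; ring.
Qed.

Variable f : 'I_p -> {mpoly C[n]}.
Hypothesis f_neq0 : forall i, f i != 0.

Definition power_symbol (a e : 'I_p -> nat) : K :=
  (\prod_(i < p) xpoly p (f i) ^+ a i)%:F / (\prod_(i < p) xpoly p (f i) ^+ e i)%:F.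

(** Provides the hypothesis [w_deriv] of the specialization at the point [z = a - e]. *)
Lemma power_symbol_deriv a e k :
  frac_deriv k (power_symbol a e) = power_symbol a e * \sum_(i < p)
    ((a i)%:R - (e i)%:R)%:MP%:F *
      ((xpoly p (f i)^`M(k))%:F / (xpoly p (f i))%:F).
Proof.
pose c i : K := (xpoly p (f i)^`M(k))%:F / (xpoly p (f i))%:F.
have fc i : log_deriv k (xpoly p (f i))%:F (c i).
  rewrite /log_deriv frac_deriv_tofrac xpoly_deriv /c mulrCA mulfV ?mulr1 //.
  exact: tofrac_xpoly_neq0.
have powc (m : 'I_p -> nat) : log_deriv k (\prod_(i < p) xpoly p (f i) ^+ m i)%:F
    (\sum_i c i *+ m i).
  rewrite rmorph_prod; apply: log_deriv_prod => i.
  by rewrite rmorphXn; apply: log_derivX; exact: fc.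
have pow0 (m : 'I_p -> nat) : (\prod_(i < p) xpoly p (f i) ^+ m i)%:F != 0 :> K.
  by rewrite tofrac_eq0; apply/prodf_neq0 => i _; rewrite expf_neq0 ?xpoly_eq0.
have := log_derivM (powc a) (log_derivV (pow0 e) (powc e)).
rewrite /log_deriv -/(power_symbol a e) => ->; congr (_ * _).
rewrite -sumrB; apply: eq_bigr => i _.
rewrite mpolyCB tofracB mulrBl; congr (_ - _);
  by rewrite mpolyC_nat rmorph_nat mulr_natl.
Qed.

End PowerSymbol.

(** * Vanishing on the hyperplanes [s_j = -1] *)

Section Necessity.

Variables (C : numFieldType) (n : nat) (A : 'M[C]_(n.+1, n)).
Hypothesis n_gt1 : (1 < n)%N.
Hypothesis generic : forall r : 'I_n -> 'I_n.+1, injective r ->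
  \rank (rowsub r A) = n.

Local Notation R := {mpoly C[n + n.+1]}.
Local Notation K := {fraction {mpoly C[n + n.+1]}}.
Local Notation lf := (form A).

Let n_gt0 : (0 < n)%N := ltnW n_gt1.

Definition point (v : 'I_n -> C) (i : 'I_(n + n.+1)) : C :=
  if split i is inl k then v k else 0.

Lemma form_point v i : (lf i).@[point v] = \sum_k A i k * v k.
Proof.
rewrite formE raddf_sum /=; apply: eq_bigr => k _.
by rewrite mevalZ mevalXU /point -[lshift _ k]/(unsplit (inl k)) unsplitK.
Qed.

Lemma generic_point j : exists v, (lf j).@[point v] = 0 /\
  forall i, i != j -> (lf i).@[point v] != 0.
Proof.
have [c [c0 _ surj]] := generic_relation generic.
pose i0 := lift j (Ordinal n_gt0).
(* The values [t i / c i] satisfy the relation when the [t i] sum to zero. Beside [j] and [i0] there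
   are [n - 1] indices with value [1], compensated at [i0] by [-(n - 1)], which is nonzero since
   [n > 1]. *)
pose t (i : 'I_n.+1) : C :=
  if i == j then 0 else if i == i0 then - (n.-1)%:R else 1.
have ji0 : i0 != j by rewrite eq_sym neq_lift.
have [|v vE] := surj (fun i => (c i)^-1 * t i).
  under eq_bigr do rewrite mulVKf //.
  rewrite (bigD1 j) //= (bigD1 i0) //= /t eqxx (negPf ji0) eqxx.
  rewrite (eq_bigr (fun=> 1)); last by move=> i /andP[/negPf-> /negPf->].
  rewrite add0r; apply/eqP; rewrite addrC subr_eq0; apply/eqP.
  have : \sum_(i < n.+1) (1 : C) = n.+1%:R by rewrite sumr_const card_ord.
  rewrite (bigD1 j) //= (bigD1 i0) //= -natr1 addrC => /addIr.
  by rewrite -[in n%:R](prednK n_gt0) -natr1 addrC => /addIr.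
exists v; split=> [|i ij]; rewrite form_point vE /t ?eqxx ?mulr0 // (negPf ij).
rewrite mulf_neq0 ?invr_neq0 //; case: (i =P i0) => _; rewrite ?oner_neq0 //.
by rewrite oppr_eq0 pnatr_eq0 -lt0n -ltnS prednK.
Qed.

Lemma bernstein_vanish_component j (a : 'I_n.+1 -> nat) b :
  bernstein_ideal (linear_form A) b ->
  b.@[fun i => if i == j then -1 else (a i)%:R] = 0.
Proof.
move=> Bb; set z := fun i => _.
pose a' i := if i == j then 0%N else a i.
pose e i : nat := (i == j).
have zE i : z i = (a' i)%:R - (e i)%:R.
  by rewrite /z /a' /e; case: eqP => _; rewrite ?sub0r ?subr0.
have lf0 i : linear_form A i != 0 by apply: linear_form_neq0.
have xf0 i : (lf i)%:F != 0 :> K by apply: tofrac_xpoly_neq0.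
have denE : \prod_(i < n.+1) lf i ^+ e i = lf j.
  by rewrite (bigD1 j) //= /e eqxx big1 ?mulr1 // => i /negPf->.
pose V (g : K) := exists q, g = q%:F.
have := @bernstein_specialize C n n.+1 (linear_form A) lf0 z
  (power_symbol (linear_form A) a' e) _ V b.
case=> [k|g h [q ->] [r ->]|q g [r ->]|k g [r ->]|||q].
- by rewrite power_symbol_deriv //; under [in RHS]eq_bigr do rewrite zE.
- by exists (q + r); rewrite tofracD.
- by exists (q * r); rewrite tofracM.
- by exists (r^`M(lshift n.+1 k)); rewrite frac_deriv_tofrac.
- exists ((\prod_(i < n.+1 | i != j) lf i) * \prod_(i < n.+1) lf i ^+ a' i).
  rewrite /power_symbol denE (bigD1 j) //= -/(lf j) 2!tofracM.
  rewrite mulrA -[X in X / _]mulrA [X in X / _]mulrC mulfK //.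
- by [].
- rewrite /power_symbol denE mulrA -tofracM => /(congr1 ( *%R^~ (lf j)%:F)) /eqP.
  rewrite divfK // -tofracM tofrac_eq => /eqP.
  (* The equation now reads [b(z) prod_i l_i^(a' i) = q l_j]; at a zero of [l_j] alone, the product
     on the left does not vanish. *)
  have [v [vj vi]] := generic_point j.
  move/(congr1 (meval (point v))); rewrite !mevalM mevalC vj mulr0 => /eqP.
  rewrite mulf_eq0 => /orP[/eqP //|]; rewrite rmorph_prod /=.
  rewrite prodf_seq_eq0 => /hasP[i _ /=]; rewrite rmorphXn /= expf_eq0 /a'.
  by case: eqP => [//|/eqP/vi/negPf->]; rewrite andbF.
Qed.

End Necessity.

(** * Poles along all of [l_1, ..., l_n] *)

Section MultipleParts.

Variables (F : fieldType) (n : nat) (V : F -> Prop) (ell kappa : 'I_n -> F).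
Hypothesis V0 : V 0.
Hypothesis VD : forall g h, V g -> V h -> V (g + h).
Hypothesis VM : forall i g, V g -> V (kappa i * g).
Hypothesis ell_neq0 : forall i, ell i != 0.

Local Notation y := (\sum_i kappa i * ell i).
Local Notation pole d := (\prod_i (ell i)^-1 ^+ d i).
Hypothesis V_pole : forall T (d : 'I_n -> nat) i, d i = 0%N -> V (y ^+ T * pole d).

Lemma pole_decr (d : 'I_n -> nat) i : (0 < d i)%N ->
  ell i * pole d = pole (fun j => d j - (j == i))%N.
Proof.
move=> di; rewrite (bigD1 i) //= [RHS](bigD1 i) //= mulrA; congr (_ * _).
  by rewrite eqxx -{1}(prednK di) exprS mulVKf // subn1.
by apply: eq_bigr => j /negPf->; rewrite subn0.
Qed.

Lemma sum_decr (d : 'I_n -> nat) i : (0 < d i)%N ->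
  (\sum_j (d j - (j == i))).+1 = (\sum_j d j)%N.
Proof.
move=> di; rewrite (bigD1 i) //= [RHS](bigD1 i) //= eqxx subn1.
rewrite -addSn prednK //; congr (_ + _)%N.
by apply: eq_bigr => j /negPf->; rewrite subn0.
Qed.

Lemma pole_expand T (d : 'I_n -> nat) : (forall i, 0 < d i)%N ->
  y ^+ T.+1 * pole d =
  \sum_i kappa i * (y ^+ T * pole (fun j => d j - (j == i))%N).
Proof.
move=> d0; rewrite exprS -mulrA mulr_suml; apply: eq_bigr => i _.
by rewrite -pole_decr // -mulrA; congr (_ * _); rewrite mulrCA.
Qed.

Lemma V_sum (I : Type) (r : seq I) (G : I -> F) :
  (forall i, V (G i)) -> V (\sum_(i <- r) G i).
Proof. by move=> VG; apply: big_ind. Qed.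

(** Each factor [y] lowers the total order of the pole by one. Either some exponent reaches zero on
    the way, or all [T] factors are spent with total order below [n], which again forces a zero
    exponent. *)
Lemma small_pole T (d : 'I_n -> nat) :
  (\sum_i d i < T + n)%N -> V (y ^+ T * pole d).
Proof.
elim: T d => [|T IH] d dT;
  case: (pickP (fun i => d i == 0)%N) => [i /eqP|d0]; try exact: V_pole.
  have : (\sum_(i < n) 1 <= \sum_i d i)%N.
    by apply: leq_sum => i _; rewrite lt0n d0.
  by rewrite sum1_card card_ord leqNgt dT.
have d0' i : (0 < d i)%N by rewrite lt0n d0.
rewrite pole_expand //; apply: V_sum => i; apply: VM; apply: IH.
by rewrite -ltnS sum_decr.
Qed.

(** In the expansion of [y^T], only the monomial [prod_i (kappa i * ell i)^(g i)] leaves a pole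
    along every [ell i]. Here [N] is its multinomial coefficient, of which only positivity is
    recorded. *)
Lemma critical_pole T (g : 'I_n -> nat) : (\sum_i g i = T)%N ->
  exists2 N : nat, (0 < N)%N &
    V (y ^+ T * pole (fun i => (g i).+1) -
       N%:R * \prod_i kappa i ^+ g i * pole (fun=> 1%N)).
Proof.
elim: T g => [|T IH] g gT.
  have g0 i : g i = 0%N.
    by apply/eqP; rewrite -leqn0 -gT (bigD1 i) //= leq_addr.
  exists 1%N => //; rewrite (_ : _ - _ = 0) // expr0 !mul1r.
  rewrite [\prod_i kappa i ^+ _]big1 => [|i _]; last by rewrite g0.
  rewrite mul1r; apply/eqP; rewrite subr_eq0; apply/eqP.
  by apply: eq_bigr => i _; rewrite g0.
(* If [g i = 0], the factor [ell i] cancels the simple pole along it and the term falls into [V],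
   contributing [0] to the coefficient. *)
have step i : exists N : nat, ((0 < g i)%N -> (0 < N)%N) /\
    V (kappa i * (y ^+ T * pole (fun j => (g j).+1 - (j == i))%N) -
       N%:R * \prod_i kappa i ^+ g i * pole (fun=> 1%N)).
  have [gi0|gi] := posnP (g i).
    exists 0%N; split=> //; rewrite !mul0r subr0; apply: VM.
    by apply: (@V_pole _ _ i); rewrite gi0 eqxx.
  have [|N N0 VN] := IH (fun j => g j - (j == i))%N.
    by apply/succn_inj; rewrite sum_decr.
  exists N; split=> //.
  have -> : \prod_j kappa j ^+ g j = kappa i * \prod_j kappa j ^+ (g j - (j == i)).
    rewrite (bigD1 i) //= [in RHS](bigD1 i) //= eqxx mulrA -exprS subn1 prednK //.
    by congr (_ * _); apply: eq_bigr => j /negPf->; rewrite subn0.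
  have := VM i VN; congr V; rewrite mulrBr; congr (_ * (_ * _) - _); last by ring.
  apply: eq_bigr => j _; congr (_ ^+ _).
  by case: eqP => [->|_]; rewrite ?subn0 ?subn1 ?prednK.
have /fin_all_exists[N /all_and2[N0 VN]] := step.
exists (\sum_i N i)%N; last first.
  rewrite pole_expand // natr_sum !mulr_suml -sumrB; exact: V_sum.
have /existsP[i gi] : [exists i, 0 < g i]%N.
  apply: contraTT isT => /existsPn g0; move: gT; rewrite big1 // => i _.
  by apply/eqP; rewrite -leqn0 leqNgt g0.
by rewrite (bigD1 i) //= addn_gt0 N0.
Qed.

End MultipleParts.

Lemma exists_sub_sum (n : nat) (D : 'I_n -> nat) T : (T <= \sum_i D i)%N ->
  exists2 g : 'I_n -> nat, (forall i, g i <= D i)%N & (\sum_i g i = T)%N.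
Proof.
elim: T => [_|T IH TD]; first by exists (fun=> 0%N) => //; rewrite big1.
have [g gD gT] := IH (ltnW TD).
have /existsP[i gi] : [exists i, g i < D i]%N.
  apply: contraLR TD => /existsPn gN; rewrite -leqNgt -gT.
  by apply: leq_sum => i _; rewrite leqNgt gN.
exists (fun j => g j + (j == i))%N => [j|].
  by case: eqP => [->|_]; rewrite ?addn1 ?addn0.
by rewrite big_split /= gT -(big_mkcond (fun j => j == i)) /= big_pred1_eq addn1.
Qed.

(** * Localization at a single polynomial *)

Section PrincipalLocalization.

Variables (C : fieldType) (n p : nat).
Local Notation R := {mpoly C[n + p]}.
Local Notation K := {fraction {mpoly C[n + p]}}.
Variable q : R.
Hypothesis q_neq0 : q != 0.

Definition in_loc (g : K) : Prop := exists (a : R) m, g = a%:F / (q ^+ m)%:F.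

Lemma in_loc_tofrac a : in_loc a%:F.
Proof. by exists a, 0%N; rewrite expr0 tofrac1 divr1. Qed.

Lemma in_locD g h : in_loc g -> in_loc h -> in_loc (g + h).
Proof.
move=> [a [m ->]] [b [l ->]]; exists (a * q ^+ l + b * q ^+ m), (m + l)%N.
by rewrite tofrac_div_add ?expf_neq0 // exprD.
Qed.

Lemma in_locM g h : in_loc g -> in_loc h -> in_loc (g * h).
Proof.
move=> [a [m ->]] [b [l ->]]; exists (a * b), (m + l)%N.
by rewrite tofrac_div_mul exprD.
Qed.

Lemma in_locX g m : in_loc g -> in_loc (g ^+ m).
Proof.
move=> gq; elim: m => [|m IH]; last by rewrite exprS; apply: in_locM.
by rewrite expr0 -tofrac1; apply: in_loc_tofrac.
Qed.

Lemma in_locV a b : q = a * b -> in_loc (a%:F)^-1.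
Proof.
move=> qE; have := q_neq0; rewrite qE mulf_eq0 negb_or => /andP[a0 b0].
exists b, 1%N; apply/eqP; rewrite expr1 -[_^-1]mul1r -tofrac1.
by rewrite tofrac_div_eq // mul1r qE mulrC.
Qed.

Lemma in_loc_deriv k g : in_loc g -> in_loc (frac_deriv k g).
Proof.
move=> [a [m ->]]; rewrite (frac_derivE k a (expf_neq0 m q_neq0)).
set u := _ - _; exists u, (m * 2)%N; by rewrite exprM.
Qed.

(** Stated for all large exponents so that finitely many elements can share one. *)
Lemma in_loc_leq g : in_loc g -> exists M, forall m, (M <= m)%N ->
  exists a : R, g * (q ^+ m)%:F = a%:F.
Proof.
move=> [a [M ->]]; exists M => m Mm; exists (a * q ^+ (m - M)).
rewrite -{1}(subnK Mm) exprD [(_ * q ^+ M)%:F]tofracM mulrA mulrAC.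
by rewrite divfK ?tofracM // tofrac_eq0 expf_neq0.
Qed.

End PrincipalLocalization.

(** * Vanishing on the hyperplanes [S = -(n + k)] *)

Section NecessityAtOrigin.

Variables (C : numFieldType) (n : nat) (A : 'M[C]_(n.+1, n)).
Hypothesis n_gt0 : (0 < n)%N.
Hypothesis generic : forall r : 'I_n -> 'I_n.+1, injective r ->
  \rank (rowsub r A) = n.

Local Notation R := {mpoly C[n + n.+1]}.
Local Notation K := {fraction {mpoly C[n + n.+1]}}.
Local Notation lf := (form A).
Local Notation L i := (lf (lift ord_max i)).
Local Notation Q i := (\prod_(j < n | j != i) L j).
Local Notation pole d := (\prod_(j < n) ((L j)%:F : K)^-1 ^+ d j).

Let lf_neq0 i : lf i != 0 := form_neq0 n_gt0 generic i.

Let Q_neq0 i : Q i != 0.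
Proof. by apply/prodf_neq0 => j _. Qed.

(* Up to the s-variables, the quotient of C[x, 1 / (l_1 ... l_n)] by partial_pole
   is C[d_1, ..., d_n] delta_0, the part supported at the origin. *)
Definition partial_pole (g : K) : Prop :=
  exists2 h : 'I_n -> K, (forall i, in_loc (Q i) (h i)) & g = \sum_i h i.

Lemma partial_poleD g h : partial_pole g -> partial_pole h -> partial_pole (g + h).
Proof.
move=> [u uQ ->] [v vQ ->]; exists (fun i => u i + v i); last by rewrite big_split.
by move=> i; apply: in_locD.
Qed.

Lemma partial_poleM a g : partial_pole g -> partial_pole (a%:F * g).
Proof.
move=> [u uQ ->]; exists (fun i => a%:F * u i); last by rewrite mulr_sumr.
by move=> i; apply: in_locM => //; apply: in_loc_tofrac.
Qed.

Lemma partial_pole_deriv k g : partial_pole g -> partial_pole (frac_deriv k g).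
Proof.
move=> [u uQ ->]; exists (fun i => frac_deriv k (u i)); last exact: frac_deriv_sum.
by move=> i; apply: in_loc_deriv.
Qed.

Lemma partial_pole1 i g : in_loc (Q i) g -> partial_pole g.
Proof.
move=> gQ; exists (fun j => if j == i then g else 0).
  move=> j; case: eqP => [->//|_]; rewrite -tofrac0; exact: in_loc_tofrac.
by rewrite (bigD1 i) //= eqxx big1 ?addr0 // => j /negPf->.
Qed.

Lemma partial_pole0 : partial_pole 0.
Proof.
by apply: (@partial_pole1 (Ordinal n_gt0)); rewrite -tofrac0; apply: in_loc_tofrac.
Qed.

Lemma partial_pole_missing (a : R) (d : 'I_n -> nat) i :
  d i = 0%N -> partial_pole (a%:F * pole d).
Proof.
move=> di; apply: partial_poleM; apply: (@partial_pole1 i).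
rewrite [X in in_loc _ X](bigD1 i) //= di expr0 mul1r.
apply: big_ind => [|g h|j ji].
- rewrite -tofrac1; exact: in_loc_tofrac.
- exact: in_locM.
- apply: in_locX; apply: (in_locV (Q_neq0 i)); exact: (bigD1 j).
Qed.

(** The forms [l_1, ..., l_n] are linear coordinates; the substitution inverts them and sends every
    [s_j] to zero. *)
Lemma exists_coordinates : exists t : (n + n.+1).-tuple {mpoly C[n]},
  forall i, (L i) \mPo t = 'X_i.
Proof.
pose u k := \sum_j invmx (rowsub (lift ord_max) A) k j *: ('X_j : {mpoly C[n]}).
exists [tuple if split m is inl k then u k else 0 | m < n + n.+1] => i.
rewrite formE raddf_sum /=.
rewrite (eq_bigr (fun k => A (lift ord_max i) k *: u k)); last first.
  move=> k _; rewrite comp_mpolyZ comp_mpolyXU -tnth_nth tnth_mktuple.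
  by rewrite -[lshift _ k]/(unsplit (inl k)) unsplitK.
have E j : \sum_k A (lift ord_max i) k * invmx (rowsub (lift ord_max) A) k j
    = (i == j)%:R.
  have /matrixP/(_ i j) := mulmxV (rowsub_lift_unit generic ord_max).
  by rewrite !mxE => <-; apply: eq_bigr => k _; rewrite !mxE.
rewrite /u; under eq_bigr do rewrite scaler_sumr.
rewrite exchange_big /=; transitivity (\sum_j (i == j)%:R *: ('X_j : {mpoly C[n]})).
  apply: eq_bigr => j _; rewrite -E scaler_suml.
  by apply: eq_bigr => k _; rewrite scalerA.
rewrite (bigD1 i) //= eqxx scale1r big1 ?addr0 // => j /negPf.
by rewrite eq_sym => ->; rewrite scale0r.
Qed.

Lemma mcoeff_mulX_small (a : {mpoly C[n]}) (i : 'I_n) N (m : 'X_{1..n}) :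
  (m i < N)%N -> (a * 'X_i ^+ N)@_m = 0.
Proof.
move=> mN; apply: memN_msupp_eq0; rewrite mpolyXn.
rewrite (perm_mem (msuppMX _ _)); apply/mapP => -[m' _ mE].
move: mN; rewrite mE mnmDE mulmnE mnm1E eqxx mul1n.
by rewrite ltnNge leq_addr.
Qed.

(* Clearing denominators would put (z_1 ... z_n)^(N-1) in the ideal (z_1^N, ..., z_n^N). *)
Lemma simple_pole_not_partial : ~ partial_pole (pole (fun=> 1%N)).
Proof.
case=> h hQ hE.
have /fin_all_exists[M hM] := fun i => in_loc_leq (Q_neq0 i) (hQ i).
pose N := (\sum_i M i).+1.
have MN i : (M i <= N)%N by rewrite ltnW // ltnS (bigD1 i) //= leq_addr.
have /fin_all_exists[a aE] := fun i => hM i N (MN i).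
have LE : \prod_j L j ^+ N.-1 = \sum_i a i * L i ^+ N.
  apply/eqP; rewrite -tofrac_eq; apply/eqP; rewrite raddf_sum /=.
  rewrite (eq_bigr (fun i => h i * (\prod_j L j ^+ N)%:F)).
    rewrite -mulr_suml -hE !rmorph_prod -big_split; apply: eq_bigr => j _ /=.
    by rewrite expr1 !tofracXn exprS mulKf // tofrac_eq0.
  move=> i _; rewrite tofracM -aE -mulrA -tofracM; congr (_ * _%:F).
  by rewrite [RHS](bigD1 i) //= prodrXl mulrC.
have [t tE] := exists_coordinates.
pose m : 'X_{1..n} := [multinom N.-1 | i < n].
have RE : ((\sum_i a i * L i ^+ N) \mPo t)@_m = 0.
  rewrite (raddf_sum (comp_mpoly t)) (raddf_sum (mcoeff m)) big1 // => i _ /=.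
  by rewrite rmorphM rmorphXn /= tE mcoeff_mulX_small // mnmE.
have := RE; rewrite -LE rmorph_prod (eq_bigr (fun i => 'X_i ^+ m i)) => [|i _];
  last by rewrite rmorphXn /= tE mnmE.
rewrite -mpolyXE_id mcoeffX eqxx => /eqP.
by rewrite oner_eq0.
Qed.

(** The nonvanishing of every [kappa i] keeps the coefficient in [critical_pole] nonzero. *)
Lemma last_form : exists2 kappa : 'I_n -> C, (forall i, kappa i != 0) &
  lf ord_max = \sum_i kappa i *: L i.
Proof.
have [c [c0 cA _]] := generic_relation generic.
exists (fun i => - (c (lift ord_max i) / c ord_max)) => [i|].
  by rewrite oppr_eq0 mulf_neq0 ?invr_neq0.
under eq_bigr do rewrite formE scaler_sumr.
rewrite exchange_big formE; apply: eq_bigr => k _ /=.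
under eq_bigr do rewrite scalerA.
rewrite -scaler_suml; congr (_ *: _); apply: (mulfI (c0 ord_max)).
have := cA k; rewrite (bigD1_ord ord_max) //= => /eqP.
rewrite addr_eq0 => /eqP->; rewrite mulr_sumr -sumrN; apply: eq_bigr => i _.
by rewrite mulNr mulrN mulrA mulrC -mulrA mulrCA mulrA divfK // mulrC.
Qed.

Lemma bernstein_vanish_origin (x : 'I_n.+1 -> nat) (t k : nat) b : (k <= n)%N ->
  (t + (n + k) = \sum_(i < n.+1 | i != ord_max) (x i).+2)%N ->
  bernstein_ideal (linear_form A) b ->
  b.@[fun i => if i == ord_max then t%:R else - (x i).+2%:R] = 0.
Proof.
move=> kn tE Bb; set z := fun i => _.
pose a (i : 'I_n.+1) := if i == ord_max then t else 0%N.
pose e (i : 'I_n.+1) := if i == ord_max then 0%N else (x i).+2.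
have zE i : z i = (a i)%:R - (e i)%:R.
  by rewrite /z /a /e; case: eqP => _; rewrite ?sub0r ?subr0.
have [kappa kappa0 yE] := last_form.
pose kF i : K := (kappa i)%:MP%:F; pose ell i : K := (L i)%:F.
have YE : (lf ord_max)%:F = \sum_i kF i * ell i.
  rewrite yE raddf_sum; apply: eq_bigr => i _ /=.
  by rewrite -mul_mpolyC tofracM.
(* The pole orders of [f^(z+1)]; those of [f^z] are larger by one. *)
pose d (i : 'I_n) := (x (lift ord_max i)).+1.
have dt : (\sum_i d i = t + k)%N.
  apply: (@addIn n); rewrite -addnA (addnC k) tE.
  rewrite [RHS]big_mkcond (bigD1_ord ord_max) //= eqxx add0n.
  transitivity (\sum_i (d i + 1))%N.
    by rewrite big_split /= sum_nat_const card_ord muln1.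
  by apply: eq_bigr => i _; rewrite eq_sym neq_lift addn1.
have ell0 i : ell i != 0 by rewrite tofrac_eq0.
have wE : power_symbol (linear_form A) a e =
    (\sum_i kF i * ell i) ^+ t * pole (fun i => (d i).+1).
  rewrite /power_symbol -YE; congr (_ * _).
    rewrite (bigD1_ord ord_max) //= /a eqxx big1 ?mulr1 ?tofracXn // => i _.
    by rewrite eq_sym (negPf (neq_lift _ _)).
  rewrite (bigD1_ord ord_max) //= /e eqxx expr0 mul1r rmorph_prod.
  rewrite -prodfV; apply: eq_bigr => i _.
  by rewrite eq_sym (negPf (neq_lift _ _)) rmorphXn exprVn.
have Vpole T (d' : 'I_n -> nat) i : d' i = 0%N ->
    partial_pole ((\sum_i kF i * ell i) ^+ T * pole d').
  by rewrite -YE -tofracXn; apply: partial_pole_missing.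
have VM i g : partial_pole g -> partial_pole (kF i * g) by apply: partial_poleM.
apply/eqP; apply: contraT => bz.
have Vw : partial_pole (power_symbol (linear_form A) a e).
  have := @bernstein_specialize C n n.+1 (linear_form A) (linear_form_neq0 generic ^~ n_gt0)
    z (power_symbol (linear_form A) a e) _ partial_pole b partial_poleD
    partial_poleM partial_pole_deriv _ Bb.
  case=> [l||h hQ hE].
  - rewrite power_symbol_deriv => [|i]; last exact: linear_form_neq0.
    by under [in RHS]eq_bigr do rewrite zE.
  - have -> : (\prod_(i < n.+1) xpoly n.+1 (linear_form A i))%:F *
        power_symbol (linear_form A) a e = (\sum_i kF i * ell i) ^+ t.+1 * pole d.
      rewrite wE (bigD1_ord ord_max) //= -/(lf ord_max) tofracM YE exprS.
      rewrite mulrACA; congr (_ * _).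
      rewrite rmorph_prod -big_split.
      apply: eq_bigr => i _ /=; rewrite exprS mulVKf //; exact: ell0.
    (* The total order [t + k] is below [t + 1 + n] because [k <= n]. *)
    apply: small_pole => //; first exact: partial_pole0.
      exact: partial_poleD.
    by rewrite dt addSn ltnS leq_add2l.
  - have := @partial_poleM (b.@[z])^-1%:MP _ (ex_intro2 _ _ h hQ hE).
    by rewrite mulrA -tofracM -mpolyCM mulVf // tofrac1 mul1r.
(* Multiplying [f^z] by [prod_i l_i^(d i - g i)] lowers its pole orders to [g i + 1] with
   [sum_i g i = t], the critical case for the factor [y^t]. *)
have [|g gd gt] := @exists_sub_sum n d t; first by rewrite dt leq_addr.
have Vg : partial_pole ((\sum_i kF i * ell i) ^+ t * pole (fun i => (g i).+1)).
  have := @partial_poleM (\prod_i L i ^+ (d i - g i)) _ Vw.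
  rewrite wE mulrCA rmorph_prod -big_split /=; congr (partial_pole (_ * _)).
  apply: eq_bigr => i _; rewrite rmorphXn -/(ell i) /=.
  rewrite -{2}(subnK (gd i)) -addnS exprD mulrA -exprMn mulfV ?ell0 //.
  by rewrite expr1n mul1r.
have [N N0 VN] := @critical_pole K n partial_pole ell kF partial_pole0
  partial_poleD VM ell0 Vpole t g gt.
case: simple_pole_not_partial.
pose c : C := N%:R * \prod_i kappa i ^+ g i.
have c0 : c != 0.
  rewrite mulf_neq0 ?pnatr_eq0 -?lt0n //; apply/prodf_neq0 => i _.
  by rewrite expf_neq0.
have cE : N%:R * \prod_i kF i ^+ g i = c%:MP%:F.
  rewrite mpolyCM tofracM mpolyC_nat rmorph_nat; congr (_ * _).
  rewrite rmorph_prod rmorph_prod; apply: eq_bigr => i _ /=.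
  by rewrite rmorphXn rmorphXn.
have : partial_pole (c%:MP%:F * pole (fun=> 1%N)).
  have := partial_poleD Vg (partial_poleM (-1) VN).
  by rewrite tofracN tofrac1 mulN1r opprB addrC subrK cE.
move/(@partial_poleM (c^-1)%:MP).
by rewrite mulrA -tofracM -mpolyCM mulVf // tofrac1 mul1r.
Qed.

End NecessityAtOrigin.

(** * The Bernstein ideal *)

Section Divisibility.

Variables (C : numFieldType) (n : nat) (A : 'M[C]_(n.+1, n)).
Hypothesis n_gt1 : (1 < n)%N.
Hypothesis generic : forall r : 'I_n -> 'I_n.+1, injective r ->
  \rank (rowsub r A) = n.

Let n_gt0 : (0 < n)%N := ltnW n_gt1.

Definition bernstein_factor (h : 'I_n.+1 + 'I_n.+1) : {mpoly C[n.+1]} :=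
  match h with
  | inl j => 'X_j + 1
  | inr k => \sum_(j < n.+1) 'X_j + (n + k)%:R
  end.

(* Zariski-dense in the hyperplane of bernstein_factor h, and disjoint from the other
   hyperplanes. *)
Definition grid (h : 'I_n.+1 + 'I_n.+1) (u : 'I_n.+1 -> C) : Prop :=
  match h with
  | inl j => exists a : 'I_n.+1 -> nat, u =1 fun i => if i == j then -1 else (a i)%:R
  | inr k => exists (x : 'I_n.+1 -> nat) t,
      (t + (n + k) = \sum_(i < n.+1 | i != ord_max) (x i).+2)%N /\
      u =1 fun i => if i == ord_max then t%:R else - (x i).+2%:R
  end.

Lemma bernstein_vanish_grid h u b :
  grid h u -> bernstein_ideal (linear_form A) b -> b.@[u] = 0.
Proof.
case: h => [j [a uE]|k [x [t [tE uE]]]] Bb; rewrite (meval_eq _ uE).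
  exact: (bernstein_vanish_component n_gt1 generic _ _ Bb).
by apply: (bernstein_vanish_origin n_gt0 generic _ tE Bb); rewrite -ltnS.
Qed.

Lemma factor_eval_inl j (u : 'I_n.+1 -> C) : (bernstein_factor (inl j)).@[u] = u j + 1.
Proof. by rewrite /= mevalD mevalXU meval1. Qed.

Lemma factor_eval_inr k (u : 'I_n.+1 -> C) :
  (bernstein_factor (inr k)).@[u] = \sum_i u i + (n + k)%:R.
Proof.
rewrite /= mevalD raddf_sum rmorph_nat; congr (_ + _).
by apply: eq_bigr => i _; apply: mevalXU.
Qed.

(** On the grid of [s_j = -1], the other [s_i + 1] are positive and [S + n + k] is at least [n - 1],
    positive as [n > 1]. On the grid of [S = -(n + k)], the factor of index [k'] takes the value
    [k' - k], and no coordinate equals [-1]. *)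
Lemma factor_grid_neq0 h h' u :
  h != h' -> grid h u -> (bernstein_factor h').@[u] != 0.
Proof.
case: h => [j hh' [a uE]|k hh' [x [t [tE uE]]]].
  case: h' hh' => [j' jj'|k _].
    rewrite factor_eval_inl uE ifN ?natr1 ?pnatr_eq0 //.
    by apply: contraNneq jj' => ->.
  rewrite factor_eval_inr (bigD1 j) //= uE eqxx.
  rewrite (eq_bigr (fun i => (a i)%:R)) => [|i /negPf ij]; last by rewrite uE ij.
  rewrite -natr_sum -addrA -natrD addrC subr_eq0 -[1]/(1%:R) eqr_nat.
  by rewrite addnCA gtn_eqF // ltn_addr.
case: h' hh' => [j _|k' kk'].
  rewrite factor_eval_inl uE; case: (j =P ord_max) => _; first by rewrite natr1 pnatr_eq0.
  by rewrite -natr1 opprD addrNK oppr_eq0 pnatr_eq0.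
rewrite factor_eval_inr (bigD1 ord_max) //= uE eqxx.
rewrite (eq_bigr (fun i => - (x i).+2%:R)) => [|i /negPf im]; last by rewrite uE im.
rewrite sumrN -natr_sum -tE natrD opprD addNKr natrD.
rewrite natrD opprD addrACA addNr add0r addrC subr_eq0 eqr_nat.
by apply: contraNneq kk' => /val_inj->.
Qed.

Lemma factor_dvd_of_grid h (a : {mpoly C[n.+1]}) :
  (forall u, grid h u -> a.@[u] = 0) -> exists q, a = q * bernstein_factor h.
Proof.
case: h => [j|k] a0 /=.
  rewrite -[1]opprK; apply: (@dvd_hyperplane_of_grid _ _ (fun m => m%:R)) => [|z].
    by move=> m m' /eqP; rewrite eqr_nat => /eqP.
  by apply: a0; exists z => i; rewrite mevalN meval1.
pose r : {mpoly C[n.+1]} :=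
  - (\sum_(i < n.+1 | i != ord_max) 'X_i + (n + k)%:R).
have -> : \sum_(j < n.+1) 'X_j + (n + k)%:R = 'X_ord_max - r.
  by rewrite (bigD1 ord_max) //= opprK addrA.
apply: (@dvd_hyperplane_of_grid _ _ (fun m => - m.+2%:R)) => [m m'|z].
  by move/oppr_inj/eqP; rewrite eqr_nat => /eqP[].
pose s := (\sum_(i < n.+1 | i != ord_max) (z i).+2)%N.
(* Each of the [n] summands is at least [2] and [k <= n], so the last coordinate [s - (n + k)] is
   natural at every point of the grid; the shift by two in [grid] ensures this. *)
have sn : (n + k <= s)%N.
  apply: (@leq_trans (\sum_(i < n.+1 | i != ord_max) 2)%N); last exact: leq_sum.
  rewrite sum_nat_const (cardC1 (ord_max : 'I_n.+1)) card_ord muln2 -addnn leq_add2l.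
  by rewrite -ltnS.
apply: a0; exists z, (s - (n + k))%N; split=> [|i]; first by rewrite subnK.
case: eqP => // _; rewrite natrB // mevalN mevalD rmorph_nat opprD; congr (_ - _).
rewrite (raddf_sum (meval _)) -sumrN natr_sum; apply: eq_bigr => i' _ /=.
by rewrite mevalXU opprK.
Qed.

Lemma bernstein_dvd b : bernstein_ideal (linear_form A) b ->
  exists q, b = q * poly_bernstein C n.
Proof.
move=> Bb.
have [|h a _ ha|h h' u _ _ hh' hu|h u _ hu|q bE] :=
    @dvd_prod_of_vanish _ C _ _ (fun u : 'I_n.+1 -> C => meval u) grid
    bernstein_factor (enum {: 'I_n.+1 + 'I_n.+1}) b.
- exact: enum_uniq.
- exact: factor_dvd_of_grid.
- exact: factor_grid_neq0 hh' hu.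
- exact: bernstein_vanish_grid hu Bb.
exists q; rewrite bE big_enum /=; congr (_ * _); exact: big_sumType.
Qed.

End Divisibility.

(** On a line, genericity makes both forms nonzero, so both kernels would be zero and coincide. *)
Lemma generic_distinct_kernels_gt1 (C : fieldType) (n : nat) (A : 'M[C]_(n.+1, n)) :
  (0 < n)%N ->
  (forall r : 'I_n -> 'I_n.+1, injective r -> \rank (rowsub r A) = n) ->
  (forall i j : 'I_n.+1, i != j ->
     ~ (forall v : 'I_n -> C,
          (linear_form A i).@[v] = 0 <-> (linear_form A j).@[v] = 0)) ->
  (1 < n)%N.
Proof.
case: n A => [|[|n]] // A _ generic distinct.
have A0 i : A i 0 != 0.
  apply: contraTneq (linear_form_neq0 generic i isT) => A0.
  by rewrite negbK /linear_form big_ord1 A0 scale0r.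
have ker i v : (linear_form A i).@[v] = 0 <-> v 0 = 0.
  rewrite linear_form_eval big_ord1; split=> [/eqP|->]; last by rewrite mulr0.
  by rewrite mulf_eq0 (negPf (A0 i)) => /eqP.
by case: (distinct ord0 ord_max isT) => v; rewrite !ker.
Qed.

Theorem mainTheorem1 (R : realType) (n : nat) (A : 'M[R[i]]_(n.+1, n))
    (n_ge1 : (1 <= n)%N)
    (generic : forall r : 'I_n -> 'I_n.+1, injective r ->
       \rank (rowsub r A) = n)
    (distinct_kernels : forall i j : 'I_n.+1, i != j ->
       ~ (forall v : 'I_n -> R[i],
            (linear_form A i).@[v] = 0 <-> (linear_form A j).@[v] = 0)) :
  forall b : {mpoly R[i][n.+1]},
    bernstein_ideal (linear_form A) b <->
    exists q : {mpoly R[i][n.+1]},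
      b = q * (\prod_(j < n.+1) ('X_j + 1) *
               \prod_(k < n.+1) (\sum_(j < n.+1) 'X_j + (n + k)%:R)).
Proof.
move=> b; have n_gt1 := generic_distinct_kernels_gt1 n_ge1 generic distinct_kernels.
split=> [/(bernstein_dvd n_gt1 generic)//|[q ->]].
have Bb := mem_poly_bernstein n_ge1 generic.
(* The generator is in the ideal, and [M] is stable under multiplication by [spoly n q]. *)
rewrite /bernstein_ideal /spoly rmorphM; exact: weyl_module_polyM.
Qed.
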